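(* Let $n=qp+r$ with integers $q\ge 0$ and $0 \leq r <p$. Then $$\dim_k \operatorname{Ext}^3_U(k, S^n) = \begin{cases} 1 & \text{if } n \leq p-3 \text{ is even},\\ \binom{q+2}{2} & \text{if } r=p-1, \\ \binom{q+1}{2} & \text{if } r \text{ is odd}, \\ \binom{q}{2} & \text{if } r<p-1 \text{ is even and } q\ge 1. \end{cases}$$
   Context: $k$ is a field of characteristic $p>2$, $\mathfrak{g}=\mathfrak{sl}_2(k)$, $U=U(\mathfrak{g})$ is its universal enveloping algebra, and $k$ is regarded as the trivial $U$-module. $S^n$ is the $n$th symmetric power of the adjoint $\mathfrak{g}$-module $\mathfrak{g}$ (with $\mathfrak g$ acting by derivations). Binomial coefficients $\binom{m}{2}$ are $0$ for $m<2$. *)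

(* Defs.v *)
From HB Require Import structures.
From mathcomp Require Import all_boot all_order all_algebra.
From mathcomp Require Import generic_quotient boolp mpoly.

Set Implicit Arguments.
Unset Strict Implicit.
Unset Printing Implicit Defensive.

Import GRing.Theory.
Local Open Scope ring_scope.
Local Open Scope quotient_scope.

HB.mixin Record Lmodule_isLieAlgebra (k : fieldType) L of GRing.Lmodule k L := {
  lie : L -> L -> L;
  lie_linearl : forall y, linear (lie^~ y);
  lie_linearr : forall x, linear (lie x);
  liexx : forall x, lie x x = 0;
  lie_jacobi : forall x y z,
    lie x (lie y z) + lie y (lie z x) + lie z (lie x y) = 0
}.

#[short(type="lieAlgType")]
HB.structure Definition LieAlgebra (k : fieldType) :=
  { L of GRing.Lmodule k L & Lmodule_isLieAlgebra k L }.

HB.mixin Record Lmodule_isLieModule (k : fieldType) (L : lieAlgType k) V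
    of GRing.Lmodule k V := {
  lact : L -> V -> V;
  lact_linearl : forall v, linear (lact^~ v);
  lact_linearr : forall x, linear (lact x);
  lact_lie : forall x y v,
    lact (lie x y) v = lact x (lact y v) - lact y (lact x v)
}.

#[short(type="lieModType")]
HB.structure Definition LieModule (k : fieldType) (L : lieAlgType k) :=
  { V of GRing.Lmodule k V & Lmodule_isLieModule k L V }.

HB.instance Definition _ (k : fieldType) (L : lieAlgType k) (x : L) :=
  GRing.isLinear.Build k L L *:%R (lie x) (lie_linearr x).

Section LieTheory.
Variables (k : fieldType) (L : lieAlgType k).
Implicit Types x y z : L.

Lemma lieC x y : lie x y = - lie y x.
Proof.
have lieDl u v w : lie (u + v) w = lie u w + lie v w.
  by have := lie_linearl w 1 u v; rewrite !scale1r.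
have := liexx (x + y); rewrite linearD /= !lieDl !liexx add0r addr0 addrC.
by move/eqP; rewrite addr_eq0 => /eqP.
Qed.

Lemma lie_lie x y z : lie (lie x y) z = lie x (lie y z) - lie y (lie x z).
Proof.
have /eqP := lie_jacobi x y z; rewrite addr_eq0 => /eqP jac.
by rewrite lieC -jac [lie z x]lieC linearN.
Qed.

End LieTheory.

(* Noncommutative polynomial expressions in the elements of L. *)
Inductive env_term (k L : Type) : Type :=
| EVar of L
| EConst of k
| EAdd of env_term k L & env_term k L
| EMul of env_term k L & env_term k L.
Arguments EVar {k L}.
Arguments EConst {k L}.

(* The congruence generated by the axioms of unital associative k-algebras,
   the linearity of EVar, and x y - y x = [x, y]; the quotient is the tensor
   algebra of L modulo the two-sided ideal generated by x y - y x - [x, y]. *)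
Inductive env_rel (k : fieldType) (L : lieAlgType k) :
    env_term k L -> env_term k L -> Prop :=
| erefl_rel s : env_rel s s
| esym_rel s t : env_rel s t -> env_rel t s
| etrans_rel s t u : env_rel s t -> env_rel t u -> env_rel s u
| eadd_congr s s' t t' :
    env_rel s s' -> env_rel t t' -> env_rel (EAdd s t) (EAdd s' t')
| emul_congr s s' t t' :
    env_rel s s' -> env_rel t t' -> env_rel (EMul s t) (EMul s' t')
| eaddA s t u : env_rel (EAdd s (EAdd t u)) (EAdd (EAdd s t) u)
| eaddC s t : env_rel (EAdd s t) (EAdd t s)
| eadd0 s : env_rel (EAdd (EConst 0) s) s
| emulA s t u : env_rel (EMul s (EMul t u)) (EMul (EMul s t) u)
| emul1 s : env_rel (EMul (EConst 1) s) s
| emul0 s : env_rel (EMul (EConst 0) s) (EConst 0)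
| emulDl s t u : env_rel (EMul (EAdd s t) u) (EAdd (EMul s u) (EMul t u))
| emulDr s t u : env_rel (EMul s (EAdd t u)) (EAdd (EMul s t) (EMul s u))
| econstD a b : env_rel (EConst (a + b)) (EAdd (EConst a) (EConst b))
| econstM a b : env_rel (EConst (a * b)) (EMul (EConst a) (EConst b))
| econstC a s : env_rel (EMul (EConst a) s) (EMul s (EConst a))
| evarD x y : env_rel (EVar (x + y)) (EAdd (EVar x) (EVar y))
| evarZ a x : env_rel (EVar (a *: x)) (EMul (EConst a) (EVar x))
| evar_lie x y :
    env_rel (EMul (EVar x) (EVar y))
            (EAdd (EMul (EVar y) (EVar x)) (EVar (lie x y))).

HB.instance Definition _ (k L : Type) := gen_eqMixin (env_term k L).
HB.instance Definition _ (k L : Type) := gen_choiceMixin (env_term k L).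

Section Envelope.
Variables (k : fieldType) (L : lieAlgType k).
Local Notation term := (env_term k L).

Definition env_eq (s t : term) : bool := `[< env_rel s t >].

Lemma env_eq_refl : reflexive env_eq.
Proof. by move=> s; apply/asboolP/erefl_rel. Qed.

Lemma env_eq_sym : ssrbool.symmetric env_eq.
Proof. by move=> s t; apply/asboolP/asboolP; apply: esym_rel. Qed.

Lemma env_eq_trans : transitive env_eq.
Proof.
by move=> t s u /asboolP st /asboolP tu; apply/asboolP/(etrans_rel st tu).
Qed.

Canonical env_equiv := EquivRel env_eq env_eq_refl env_eq_sym env_eq_trans.

Definition envelope := {eq_quot env_equiv}.
HB.instance Definition _ := Choice.on envelope.

Local Notation cls := (\pi_envelope : term -> envelope).

Lemma cls_eq s t : env_rel s t -> cls s = cls t.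
Proof. by move=> st; apply/eqmodP/asboolP. Qed.

Lemma cls_rel s t : cls s = cls t -> env_rel s t.
Proof. by move/eqmodP/asboolP. Qed.

Lemma cls_repr u : cls (repr u) = u. Proof. exact: reprK. Qed.

Lemma repr_cls s : env_rel (repr (cls s)) s.
Proof. by apply/cls_rel/cls_repr. Qed.

Definition env_const (a : k) : envelope := cls (EConst a).
Definition env_add (u v : envelope) : envelope := cls (EAdd (repr u) (repr v)).
Definition env_mul (u v : envelope) : envelope := cls (EMul (repr u) (repr v)).
Definition env_opp (u : envelope) : envelope := env_mul (env_const (-1)) u.
Definition env_scale (a : k) (u : envelope) : envelope :=
  env_mul (env_const a) u.
Definition env_in (x : L) : envelope := cls (EVar x).

Lemma cls_add s t : env_add (cls s) (cls t) = cls (EAdd s t).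
Proof. by apply/cls_eq/eadd_congr; apply: repr_cls. Qed.

Lemma cls_mul s t : env_mul (cls s) (cls t) = cls (EMul s t).
Proof. by apply/cls_eq/emul_congr; apply: repr_cls. Qed.

Lemma envP (P : envelope -> Prop) : (forall s, P (cls s)) -> forall u, P u.
Proof. by move=> Pcls u; rewrite -(cls_repr u). Qed.

Lemma env_addA : associative env_add.
Proof.
elim/envP=> s; elim/envP=> t; elim/envP=> u; rewrite !cls_add.
exact/cls_eq/eaddA.
Qed.

Lemma env_addC : commutative env_add.
Proof.
by elim/envP=> s; elim/envP=> t; rewrite !cls_add; apply/cls_eq/eaddC.
Qed.

Lemma env_add0 : left_id (env_const 0) env_add.
Proof. by elim/envP=> s; rewrite !cls_add; apply/cls_eq/eadd0. Qed.

Lemma env_mulA : associative env_mul.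
Proof.
elim/envP=> s; elim/envP=> t; elim/envP=> u; rewrite !cls_mul.
exact/cls_eq/emulA.
Qed.

Lemma env_mul1l : left_id (env_const 1) env_mul.
Proof. by elim/envP=> s; rewrite !cls_mul; apply/cls_eq/emul1. Qed.

Lemma env_constC a u : env_mul (env_const a) u = env_mul u (env_const a).
Proof. by elim/envP: u => s; rewrite !cls_mul; apply/cls_eq/econstC. Qed.

Lemma env_mul1r : right_id (env_const 1) env_mul.
Proof. by move=> u; rewrite -env_constC env_mul1l. Qed.

Lemma env_mulDl : left_distributive env_mul env_add.
Proof.
elim/envP=> s; elim/envP=> t; elim/envP=> u; rewrite !(cls_add, cls_mul).
exact/cls_eq/emulDl.
Qed.

Lemma env_mulDr : right_distributive env_mul env_add.
Proof.
elim/envP=> s; elim/envP=> t; elim/envP=> u; rewrite !(cls_add, cls_mul).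
exact/cls_eq/emulDr.
Qed.

Lemma env_constD a b : env_const (a + b) = env_add (env_const a) (env_const b).
Proof. by rewrite cls_add; apply/cls_eq/econstD. Qed.

Lemma env_constM a b : env_const (a * b) = env_mul (env_const a) (env_const b).
Proof. by rewrite cls_mul; apply/cls_eq/econstM. Qed.

Lemma env_mul0 u : env_mul (env_const 0) u = env_const 0.
Proof. by elim/envP: u => s; rewrite !cls_mul; apply/cls_eq/emul0. Qed.

Lemma env_addN : left_inverse (env_const 0) env_opp env_add.
Proof.
move=> u; rewrite -[X in env_add _ X]env_mul1l -env_mulDl -env_constD.
by rewrite addNr env_mul0.
Qed.

Fixpoint env_eps (s : term) : k :=
  match s with
  | EVar _ => 0
  | EConst a => a
  | EAdd s t => env_eps s + env_eps t
  | EMul s t => env_eps s * env_eps t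
  end.

Lemma env_eps_rel s t : env_rel s t -> env_eps s = env_eps t.
Proof.
elim=> //=.
- by move=> s1 t1 u1 _ -> _ ->.
- by move=> s1 s2 t1 t2 _ -> _ ->.
- by move=> s1 s2 t1 t2 _ -> _ ->.
- by move=> *; rewrite addrA.
- by move=> *; rewrite addrC.
- by move=> *; rewrite add0r.
- by move=> *; rewrite mulrA.
- by move=> *; rewrite mul1r.
- by move=> *; rewrite mul0r.
- by move=> *; rewrite mulrDl.
- by move=> *; rewrite mulrDr.
- by move=> *; rewrite mulrC.
- by rewrite addr0.
- by move=> *; rewrite mulr0.
- by move=> *; rewrite mulr0 addr0.
Qed.

Lemma env_1_neq0 : env_const 1 != env_const 0.
Proof.
by apply/eqP=> /cls_rel/env_eps_rel /= /eqP; rewrite oner_eq0.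
Qed.

HB.instance Definition _ := GRing.isZmodule.Build envelope
  env_addA env_addC env_add0 env_addN.
HB.instance Definition _ := GRing.Zmodule_isNzRing.Build envelope
  env_mulA env_mul1l env_mul1r env_mulDl env_mulDr env_1_neq0.

Lemma env_scaleA a b u : env_scale a (env_scale b u) = env_scale (a * b) u.
Proof. by rewrite /env_scale env_mulA env_constM. Qed.

Lemma env_scale1 : left_id 1 env_scale.
Proof. exact: env_mul1l. Qed.

Lemma env_scaleDr : right_distributive env_scale +%R.
Proof. by move=> a u v; apply: env_mulDr. Qed.

Lemma env_scaleDl u : {morph env_scale^~ u : a b / a + b}.
Proof. by move=> a b; rewrite /env_scale env_constD env_mulDl. Qed.

HB.instance Definition _ := GRing.Zmodule_isLmodule.Build k envelope
  env_scaleA env_scale1 env_scaleDr env_scaleDl.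

Lemma env_scaleAl (a : k) (u v : envelope) : a *: (u * v) = a *: u * v.
Proof. exact: env_mulA. Qed.

HB.instance Definition _ := GRing.Lmodule_isLalgebra.Build k envelope
  env_scaleAl.

Lemma env_scaleAr (a : k) (u v : envelope) : a *: (u * v) = u * (a *: v).
Proof.
rewrite env_scaleAl; change (env_mul (env_mul (env_const a) u) v =
  env_mul u (env_mul (env_const a) v)).
by rewrite env_constC env_mulA.
Qed.

HB.instance Definition _ := GRing.Lalgebra_isAlgebra.Build k envelope
  env_scaleAr.

Lemma env_in_linear : linear env_in.
Proof.
move=> a x y; have -> : env_in (a *: x + y) = env_in (a *: x) + env_in y.
  by rewrite [RHS]cls_add; apply/cls_eq/evarD.
by congr (_ + _); rewrite [RHS]cls_mul; apply/cls_eq/evarZ.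
Qed.

HB.instance Definition _ :=
  GRing.isLinear.Build k L envelope *:%R env_in env_in_linear.

Lemma env_in_lie x y :
  env_in (lie x y) = env_in x * env_in y - env_in y * env_in x.
Proof.
apply/eqP; rewrite eq_sym subr_eq addrC; apply/eqP.
have clsM s t : cls s * cls t = cls (EMul s t) by apply: cls_mul.
have clsD s t : cls s + cls t = cls (EAdd s t) by apply: cls_add.
by rewrite !clsM clsD; apply/cls_eq/evar_lie.
Qed.

Section UniversalProperty.
Variables (A : algType k) (phi : {linear L -> A}).
Hypothesis phi_lie :
  forall x y, phi (lie x y) = phi x * phi y - phi y * phi x.

Fixpoint env_eval (s : term) : A :=
  match s with
  | EVar x => phi x
  | EConst a => a%:A
  | EAdd s t => env_eval s + env_eval t
  | EMul s t => env_eval s * env_eval t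
  end.

Lemma env_eval_rel s t : env_rel s t -> env_eval s = env_eval t.
Proof.
elim=> //=.
- by move=> s1 t1 u1 _ -> _ ->.
- by move=> s1 s2 t1 t2 _ -> _ ->.
- by move=> s1 s2 t1 t2 _ -> _ ->.
- by move=> *; rewrite addrA.
- by move=> *; rewrite addrC.
- by move=> *; rewrite scale0r add0r.
- by move=> *; rewrite mulrA.
- by move=> *; rewrite scale1r mul1r.
- by move=> *; rewrite scale0r mul0r.
- by move=> *; rewrite mulrDl.
- by move=> *; rewrite mulrDr.
- by move=> *; rewrite scalerDl.
- by move=> *; rewrite -scalerAl mul1r scalerA.
- by move=> *; rewrite -scalerAl -scalerAr mul1r mulr1.
- by move=> *; rewrite linearD.
- by move=> *; rewrite linearZ /= -scalerAl mul1r.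
- by move=> *; rewrite phi_lie addrC subrK.
Qed.

Lemma env_lift :
  exists2 Phi : {lrmorphism envelope -> A}, (forall x, Phi (env_in x) = phi x)
    & forall Psi : {lrmorphism envelope -> A},
        (forall x, Psi (env_in x) = phi x) -> Psi =1 Phi.
Proof.
pose Phi (u : envelope) : A := env_eval (repr u).
have PhiE s : Phi (cls s) = env_eval s by apply/env_eval_rel/repr_cls.
have PhiM : monoid_morphism Phi.
  split=> [|u v]; first by rewrite [LHS]PhiE /= scale1r.
  by rewrite [LHS]PhiE.
have PhiL : linear Phi.
  move=> a u v; rewrite [LHS]PhiE /=; congr (_ + _).
  transitivity (Phi (a *: u)) => //; rewrite [LHS]PhiE /= -[Phi u]mul1r.
  by rewrite scalerAl; congr (_ * _); apply: (PhiE (EConst a)).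
pose mixL := GRing.isLinear.Build _ _ _ *:%R Phi PhiL.
pose mixM := GRing.isMonoidMorphism.Build _ _ Phi PhiM.
pose PhiT : {lrmorphism envelope -> A} := HB.pack Phi mixL mixM.
exists PhiT => [x|Psi PsiE u]; first exact: (PhiE (EVar x)).
change (Psi u = Phi u); elim/envP: u => s; rewrite PhiE.
have clsM s' t : cls (EMul s' t) = cls s' * cls t by rewrite -cls_mul.
have clsD s' t : cls (EAdd s' t) = cls s' + cls t by rewrite -cls_add.
elim: s => [x|a|s IHs t IHt|s IHs t IHt] /=.
- exact: PsiE.
- rewrite -(rmorph1 Psi) -linearZ /=; congr (Psi _).
  by rewrite -[LHS]env_mul1r.
- by rewrite clsD -IHs -IHt; apply: (rmorphD Psi).
- by rewrite clsM -IHs -IHt; apply: (rmorphM Psi).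
Qed.

End UniversalProperty.
End Envelope.

Section EnvModule.
Variables (k : fieldType) (L : lieAlgType k) (V : lieModType L).

Fixpoint env_act (s : env_term k L) (v : V) : V :=
  match s with
  | EVar x => lact x v
  | EConst a => a *: v
  | EAdd s t => env_act s v + env_act t v
  | EMul s t => env_act s (env_act t v)
  end.

Lemma env_act_linear s : linear (env_act s).
Proof.
elim: s => [x|b|s IHs t IHt|s IHs t IHt] a v w /=.
- exact: lact_linearr.
- by rewrite scalerDr !scalerA mulrC.
- by rewrite IHs IHt scalerDr addrACA.
- by rewrite IHt IHs.
Qed.

Lemma env_act_rel s t : env_rel s t -> env_act s =1 env_act t.
Proof.
elim=> /=; rewrite /eqfun /=; do ?by [].
- by move=> s1 t1 u1 _ IH1 _ IH2 v; rewrite IH1 IH2.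
- by move=> s1 s2 t1 t2 _ IH1 _ IH2 v; rewrite IH1 IH2.
- by move=> s1 s2 t1 t2 _ IH1 _ IH2 v; rewrite IH2 IH1.
- by move=> *; rewrite addrA.
- by move=> *; rewrite addrC.
- by move=> *; rewrite scale0r add0r.
- by move=> *; rewrite scale1r.
- by move=> *; rewrite !scale0r.
- move=> s1 t1 u1 v.
  by have := env_act_linear s1 1 (env_act t1 v) (env_act u1 v); rewrite !scale1r.
- by move=> *; rewrite scalerDl.
- by move=> *; rewrite scalerA.
- move=> a s1 v; have s0 : env_act s1 0 = 0.
    by have := env_act_linear s1 (-1) 0 0; rewrite !scaleN1r oppr0 addr0 addNr.
  by have := env_act_linear s1 a v 0; rewrite s0 !addr0.
- by move=> x y v; have := lact_linearl v 1 x y; rewrite !scale1r.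
- move=> a x v; have x0 : lact (0 : L) v = 0.
    by have := lact_linearl v (-1) 0 0; rewrite !scaleN1r oppr0 addr0 addNr.
  by have := lact_linearl v a x 0; rewrite x0 !addr0.
- by move=> x y v; rewrite lact_lie addrC subrK.
Qed.

Definition env_module : Type := V.
HB.instance Definition _ := GRing.Zmodule.on env_module.

Definition env_module_scale (u : envelope L) (v : env_module) : env_module :=
  env_act (repr u) v.

Lemma env_module_scaleE s (v : env_module) :
  env_module_scale (\pi_(envelope L) s) v = env_act s v.
Proof. exact/env_act_rel/repr_cls. Qed.

Lemma env_module_scaleA u w v :
  env_module_scale u (env_module_scale w v) = env_module_scale (u * w) v.
Proof. by rewrite [RHS]env_module_scaleE. Qed.

Lemma env_module_scale1 : left_id 1 env_module_scale.
Proof. by move=> v; rewrite env_module_scaleE /= scale1r. Qed.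

Lemma env_module_scaleDr : right_distributive env_module_scale +%R.
Proof.
by move=> u v w; have := env_act_linear (repr u) 1 v w; rewrite !scale1r.
Qed.

Lemma env_module_scaleDl v : {morph env_module_scale^~ v : u w / u + w}.
Proof. by move=> u w; rewrite [LHS]env_module_scaleE. Qed.

HB.instance Definition _ := GRing.Zmodule_isLmodule.Build (envelope L)
  env_module env_module_scaleA env_module_scale1 env_module_scaleDr
  env_module_scaleDl.

Lemma env_module_inE (x : L) (v : env_module) :
  env_in x *: v = lact x (v : V).
Proof. exact: env_module_scaleE (EVar x) v. Qed.

Lemma env_module_algE (a : k) (v : env_module) :
  (a%:A : envelope L) *: v = a *: (v : V).
Proof.
transitivity (env_module_scale (env_const L a) v).
  by congr (_ *: v); apply: env_mul1r.
exact: env_module_scaleE (EConst a) v.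
Qed.

End EnvModule.

Definition trivial_module (k : fieldType) (L : lieAlgType k) : Type := k.
HB.instance Definition _ (k : fieldType) (L : lieAlgType k) :=
  GRing.Lmodule.copy (trivial_module L) k^o.

Section TrivialModule.
Variables (k : fieldType) (L : lieAlgType k).
Local Notation V := (trivial_module L).
Let act (x : L) (v : V) : V := 0.

Let act_linearl v : linear (act^~ v).
Proof. by move=> a x y; rewrite /act scaler0 addr0. Qed.

Let act_linearr x : linear (act x).
Proof. by move=> a v w; rewrite /act scaler0 addr0. Qed.

Let act_lie x y v : act (lie x y) v = act x (act y v) - act y (act x v).
Proof. by rewrite /act subr0. Qed.

HB.instance Definition _ := Lmodule_isLieModule.Build k L V
  act_linearl act_linearr act_lie.
End TrivialModule.

Section Ext.
Variables (k : fieldType) (A : algType k).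

Definition projective (P : lmodType A) : Prop :=
  forall (X Y : lmodType A) (g : {linear X -> Y}) (f : {linear P -> Y}),
    (forall y, exists x, g x = y) ->
    exists h : {linear P -> X}, forall x, g (h x) = f x.

Record proj_resolution (M : lmodType A) := ProjResolution {
  res_mod : nat -> lmodType A;
  res_diff : forall i, {linear res_mod i.+1 -> res_mod i};
  res_aug : {linear res_mod 0%N -> M};
  res_projective : forall i, projective (res_mod i);
  res_aug_surj : forall m, exists x, res_aug x = m;
  res_exact0 : forall x, res_aug x = 0 <-> exists y, res_diff 0 y = x;
  res_exactS : forall i x,
    res_diff i x = 0 <-> exists y, res_diff i.+1 y = x
}.

Section Cohomology.
Variables (M N : lmodType A) (P : proj_resolution M).

Definition cocycle i (f : {linear res_mod P i -> N}) : Prop :=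
  forall x, f (res_diff P i x) = 0.

Definition coboundary i : {linear res_mod P i -> N} -> Prop :=
  match i with
  | 0 => fun f => forall x, f x = 0
  | j.+1 => fun f =>
      exists g : {linear res_mod P j -> N}, forall x, f x = g (res_diff P j x)
  end.

(* The k-vector space H^i(Hom_A(P, N)) of cocycles modulo coboundaries has a
   basis of d elements, namely the classes of the z j. *)
Definition cohomology_dim i d : Prop :=
  exists z : 'I_d -> {linear res_mod P i -> N},
    (forall j, cocycle (z j)) /\
    forall f : {linear res_mod P i -> N}, cocycle f ->
      exists! c : 'rV[k]_d, exists2 b : {linear res_mod P i -> N},
        coboundary b & forall x, f x = \sum_j (c 0 j)%:A *: z j x + b x.

End Cohomology.

(* dim_k Ext^i_A(M, N) = d.  Ext does not depend on the projective resolution;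
   the first conjunct keeps the second one from being vacuous. *)
Definition Ext_dim i (M N : lmodType A) d : Prop :=
  inhabited (proj_resolution M) /\
  forall P : proj_resolution M, cohomology_dim N P i d.

End Ext.

Section Sl2.
Variable k : fieldType.

Definition traceless : {pred 'M[k]_2} := fun A => \tr A == 0.

Lemma traceless_submod_closed : submod_closed traceless.
Proof.
split=> [|a A B]; rewrite !unfold_in ?mxtrace0 //.
by move=> /eqP trA /eqP trB; rewrite mxtraceD mxtraceZ trA trB mulr0 addr0.
Qed.

HB.instance Definition _ := GRing.isSubmodClosed.Build k 'M[k]_2 traceless
  traceless_submod_closed.

Record sl2 := Sl2 { mx_of_sl2 :> 'M[k]_2; _ : mx_of_sl2 \in traceless }.

HB.instance Definition _ := [isSub for mx_of_sl2].
HB.instance Definition _ := [Choice of sl2 by <:].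
HB.instance Definition _ := [SubChoice_isSubLmodule of sl2 by <:].

Lemma sl2_comm_traceless (x y : sl2) : x *m y - y *m x \in traceless.
Proof. by rewrite unfold_in raddfB /= [X in _ - X]mxtrace_mulC subrr. Qed.

Definition sl2_lie (x y : sl2) : sl2 := Sl2 (sl2_comm_traceless x y).

Lemma mx_of_sl2_linear : linear mx_of_sl2.
Proof. exact: (linearP (val : sl2 -> 'M[k]_2)). Qed.

HB.instance Definition _ :=
  GRing.isLinear.Build k sl2 'M[k]_2 *:%R mx_of_sl2 mx_of_sl2_linear.

Let lie_linl y : linear (sl2_lie^~ y).
Proof.
move=> a x x'; apply: val_inj.
rewrite [RHS](linearP (val : sl2 -> 'M[k]_2)) /=.
by rewrite mulmxDl mulmxDr -scalemxAl -scalemxAr scalerBr opprD addrACA.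
Qed.

Let lie_linr x : linear (sl2_lie x).
Proof.
move=> a y y'; apply: val_inj.
rewrite [RHS](linearP (val : sl2 -> 'M[k]_2)) /=.
by rewrite mulmxDl mulmxDr -scalemxAl -scalemxAr scalerBr opprD addrACA.
Qed.

Let liexx0 x : sl2_lie x x = 0.
Proof. by apply: val_inj; rewrite /= subrr. Qed.

Lemma mx_jacobi n (x y z : 'M[k]_n) :
  x *m (y *m z - z *m y) - (y *m z - z *m y) *m x
  + (y *m (z *m x - x *m z) - (z *m x - x *m z) *m y)
  + (z *m (x *m y - y *m x) - (x *m y - y *m x) *m z) = 0.
Proof.
rewrite !(mulmxBl, mulmxBr) !mulmxA !opprB; set a := x *m y *m z.
set b := x *m z *m y; set c := y *m z *m x; set d := z *m y *m x.
set e := y *m x *m z; set f := z *m x *m y.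
rewrite [a - b + _]addrACA [c - e + _]addrACA [f - d + _]addrACA -!opprD.
rewrite [c + b]addrC [f + e]addrC [d + a]addrC.
by rewrite !subrKA subrr.
Qed.

Let jacobi x y z :
  sl2_lie x (sl2_lie y z) + sl2_lie y (sl2_lie z x)
    + sl2_lie z (sl2_lie x y) = 0.
Proof. by apply: val_inj; apply: mx_jacobi. Qed.

HB.instance Definition _ := Lmodule_isLieAlgebra.Build k sl2
  lie_linl lie_linr liexx0 jacobi.

Lemma sl2E_traceless : delta_mx 0 1 \in traceless.
Proof. by rewrite unfold_in /mxtrace !big_ord_recl big_ord0 !mxE /= !addr0. Qed.

Lemma sl2H_traceless : delta_mx 0 0 - delta_mx 1 1 \in traceless.
Proof.
rewrite unfold_in /mxtrace !big_ord_recl big_ord0 !mxE /=.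
by rewrite subr0 sub0r addr0 subrr.
Qed.

Lemma sl2F_traceless : delta_mx 1 0 \in traceless.
Proof. by rewrite unfold_in /mxtrace !big_ord_recl big_ord0 !mxE /= !addr0. Qed.

Definition sl2_basis : 3.-tuple sl2 :=
  [tuple Sl2 sl2E_traceless; Sl2 sl2H_traceless; Sl2 sl2F_traceless].

Definition sl2_coord (x : sl2) (i : 'I_3) : k :=
  tnth [tuple x 0 1; x 0 0; x 1 0] i.

Lemma sl2_coord_linear i : linear (sl2_coord^~ i : sl2 -> k^o).
Proof.
move=> a x y; rewrite /sl2_coord !(tnth_nth 0).
by case: i => [[|[|[|[]]]]] //= _; rewrite !mxE.
Qed.

Lemma sl2_coordE x : x = \sum_i sl2_coord x i *: tnth sl2_basis i.
Proof.
have x11 : x 1 1 = - x 0 0.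
  have /eqP := valP x; rewrite /mxtrace !big_ord_recl big_ord0 addr0 addrC.
  by move/eqP; rewrite addr_eq0 => /eqP <-; congr (x _ _); apply: val_inj.
apply: val_inj; transitivity (x 0 1 *: delta_mx 0 1
    + (x 0 0 *: (delta_mx 0 0 - delta_mx 1 1) + x 1 0 *: delta_mx 1 0)
      : 'M[k]_2); last by rewrite !big_ord_recl big_ord0 addr0.
apply/matrixP => i j; rewrite !mxE.
case: i => [[|[|[]]]] // ilt; case: j => [[|[|[]]]] // jlt.
- rewrite /= !mulr0 subr0 mulr1 add0r addr0.
  by congr (x _ _); apply: val_inj.
- rewrite /= subr0 !mulr0 mulr1 !addr0.
  by congr (x _ _); apply: val_inj.
- rewrite /= subr0 !mulr0 mulr1 !add0r.
  by congr (x _ _); apply: val_inj.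
- rewrite /= sub0r !mulr0 mulrN1 add0r addr0 -x11.
  by congr (x _ _); apply: val_inj.
Qed.

(* The symmetric algebra S(sl_2) is the polynomial ring in the elements of
   sl2_basis, with sl2_form the inclusion of sl_2 as its linear forms; sl2_der x
   is the derivation extending the adjoint action of x (see sl2_derM and
   sl2_der_form below). *)
Definition sl2_form (x : sl2) : {mpoly k[3]} := \sum_i sl2_coord x i *: 'X_i.

Definition sl2_der (x : sl2) (p : {mpoly k[3]}) : {mpoly k[3]} :=
  \sum_i sl2_form (lie x (tnth sl2_basis i)) * p^`M(i).

Lemma sl2_form_linear : linear sl2_form.
Proof.
move=> a x y; rewrite /sl2_form scaler_sumr -big_split; apply: eq_bigr => i _.
by rewrite sl2_coord_linear scalerDl scalerA.
Qed.

HB.instance Definition _ :=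
  GRing.isLinear.Build k sl2 {mpoly k[3]} *:%R sl2_form sl2_form_linear.

Lemma sl2_form_homog x : sl2_form x \is 1.-homog.
Proof.
by apply: rpred_sum => i _; apply/rpredZ; rewrite dhomogX /= mdeg1.
Qed.

Lemma sl2_der_linearl p : linear (sl2_der^~ p).
Proof.
move=> a x y; rewrite /sl2_der scaler_sumr -big_split; apply: eq_bigr => i _.
by rewrite lie_linearl linearP mulrDl scalerAl.
Qed.

Lemma sl2_der_linearr x : linear (sl2_der x).
Proof.
move=> a p q; rewrite /sl2_der scaler_sumr -big_split; apply: eq_bigr => i _.
by rewrite linearP mulrDr scalerAr.
Qed.

HB.instance Definition _ x :=
  GRing.isLinear.Build k {mpoly k[3]} {mpoly k[3]} *:%R (sl2_der x)
    (sl2_der_linearr x).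

Lemma sl2_derM x p q : sl2_der x (p * q) = sl2_der x p * q + p * sl2_der x q.
Proof.
rewrite /sl2_der mulr_suml mulr_sumr -big_split; apply: eq_bigr => i _.
by rewrite mderivM mulrDr !mulrA [p * _]mulrC.
Qed.

Lemma sl2_der_form x y : sl2_der x (sl2_form y) = sl2_form (lie x y).
Proof.
rewrite [in RHS](sl2_coordE y) !linear_sum; apply: eq_bigr => i _ /=.
rewrite !linearZ /=; congr (_ *: _).
rewrite /sl2_der (bigD1 i) //= mderivX mnm1E eqxx scale1r -{1}[U_(i)%MM]add0m.
rewrite addmK mpolyX0 mulr1.
rewrite big1 ?addr0 // => j ji.
by rewrite mderivX mnm1E eq_sym (negPf ji) scale0r mulr0.
Qed.

Lemma sl2_der_lie x y p :
  sl2_der (lie x y) p = sl2_der x (sl2_der y p) - sl2_der y (sl2_der x p).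
Proof.
have derder x' y' : sl2_der x' (sl2_der y' p) =
    \sum_i sl2_form (lie x' (lie y' (tnth sl2_basis i))) * p^`M(i)
    + \sum_i \sum_j sl2_form (lie y' (tnth sl2_basis i))
        * (sl2_form (lie x' (tnth sl2_basis j)) * p^`M(i)^`M(j)).
  rewrite {2}/sl2_der linear_sum -big_split; apply: eq_bigr => i _ /=.
  by rewrite sl2_derM sl2_der_form [sl2_der x' p^`M(i)]/sl2_der mulr_sumr.
rewrite !derder; set S := \sum_i \sum_j _; set T := \sum_i \sum_j _.
have -> : T = S.
  rewrite [S]exchange_big; apply: eq_bigr => i _; apply: eq_bigr => j _.
  by rewrite mulrCA mderiv_comm.
rewrite opprD addrACA subrr addr0 -sumrB; apply: eq_bigr => i _.
rewrite -mulrBl -linearB /=; congr (sl2_form _ * _).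
exact: lie_lie.
Qed.

Lemma sl2_der_homog x n (p : {mpoly k[3]}) :
  p \is n.-homog -> sl2_der x p \is n.-homog.
Proof.
move=> /dhomogP homp; apply: rpred_sum => i _.
rewrite /mderiv mulr_sumr big_seq; apply: rpred_sum => m.
move=> /(homp m) degm; have [->|mi] := posnP (m i).
  by rewrite mulr0n mul0r scale0r mulr0 rpred0.
have Ui_le : (U_(i) <= m)%MM by rewrite lep1mP -lt0n.
have -> : n = (1 + mdeg (m - U_(i))%MM)%N.
  have <- : mdeg m = n by exact: degm.
  by rewrite -{1}(submK Ui_le) mdegD mdeg1 addnC.
apply: dhomogM; first exact: sl2_form_homog.
by apply: rpredZ; rewrite dhomogX /=.
Qed.

End Sl2.

(* The n-th symmetric power of the adjoint module: homogeneous polynomials of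
   degree n. *)
Definition sl2_sym (k : fieldType) (n : nat) : Type := dhomog 3 k n.
HB.instance Definition _ (k : fieldType) (n : nat) :=
  GRing.Lmodule.on (sl2_sym k n).

Section SymmetricPower.
Variables (k : fieldType) (n : nat).

Definition sl2_sym_act (x : sl2 k) (p : sl2_sym k n) : sl2_sym k n :=
  DHomog (sl2_der_homog x (dhomog_is_dhomog p)).

Let act_linearl v : linear (sl2_sym_act^~ v).
Proof.
move=> a x y; apply: val_inj.
by rewrite [RHS](linearP (val : sl2_sym k n -> _)) /= sl2_der_linearl.
Qed.

Let act_linearr x : linear (sl2_sym_act x).
Proof.
move=> a v w; apply: val_inj.
by rewrite [RHS](linearP (val : sl2_sym k n -> _)) /= sl2_der_linearr.
Qed.

Let act_lie x y v : sl2_sym_act (lie x y) v =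
  sl2_sym_act x (sl2_sym_act y v) - sl2_sym_act y (sl2_sym_act x v).
Proof.
apply: val_inj.
by rewrite [RHS](raddfB (val : sl2_sym k n -> _)) /= sl2_der_lie.
Qed.

HB.instance Definition _ := Lmodule_isLieModule.Build k (sl2 k) (sl2_sym k n)
  act_linearl act_linearr act_lie.
End SymmetricPower.

(* Main.v *)
Require Import Defs.
From HB Require Import structures.
From mathcomp Require Import all_boot all_order all_algebra.
From mathcomp Require Import generic_quotient boolp mpoly ring zify.

Set Implicit Arguments.
Unset Strict Implicit.
Unset Printing Implicit Defensive.

Import GRing.Theory.
Local Open Scope ring_scope.

(** Write e, h, f for the standard basis of sl_2 and U for its enveloping
    algebra. The proof has two halves.

    Homological half. The monomials e^i h^j f^l form a basis of U
    ([pbw_ehf_inj], [pbw_ehf_surj]). It makes the Chevalley-Eilenberg complex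
      0 -> U -> U^3 -> U^3 -> U -> k -> 0
    exact ([ce_resolution]): a cycle is cleared of its multiples of f, then of
    h, then of e. The last differential sends u to (u f, - u h, u e), so
    Ext^3(k, V) is V modulo e V + h V + f V ([Ext3_coinvariants]): this is
    Poincare duality for the unimodular Lie algebra sl_2. A comparison of
    projective resolutions ([cohomology_dim_indep]) makes one resolution
    enough.

    Combinatorial half. Let v(a, c) be the monomial e^a h^b f^c of degree n,
    so that b = n - a - c. In the coinvariants of S^n, the operator h kills
    v(a, c) unless a = c modulo p, and for such a and c both e and f give
      2 (b - 1) v(a + 1, c + 1) = (c + 1) v(a, c).
    Write a = i p + s and c = m p + s with 0 <= s < p. For fixed i and m the
    relation links the v(a, c) into a chain indexed by s. The right coefficient
    vanishes when s = p - 1. If n + 1 = Q p + 2 t with 0 <= t < p then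
    b - 1 = 2 (t - s - 1) modulo p, so the left one vanishes when s = t - 1.
    The chain therefore falls into a high part s >= t and a low part s < t.
    - The high part is nonempty exactly when i + m < Q. It contributes one
      dimension: its monomials are proportional and an invariant linear form
      detects them ([block_reduce], [block_form_invariant]).
    - The low part is 0: if i + m <= Q the broken link at s = t - 1 kills it
      ([block_low]), and if i + m > 0 the relations with source of exponent
      i p - 1 or m p - 1 kill its beginning ([block_high]).
    Hence the dimension is the number of pairs (i, m) with i + m < Q, that is
    'C(Q + 1, 2) ([Ext3_generic]). The values of (t, Q) are (0, q + 1) if
    r = p - 1, ((r + 1) / 2, q) if r is odd, and ((r + 1 + p) / 2, q - 1) if r
    is even, r < p - 1 and q > 0. If n <= p - 3 is even, then Q would be - 1,
    there is no high part, and the low part of i = m = 0 survives: it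
    contributes the single dimension ([Ext3_small_even]). *)

(** * Comparison of projective resolutions *)

Definition linear_map (A : nzRingType) (X Y : lmodType A) (f : X -> Y)
    (f_linear : linear f) : {linear X -> Y} :=
  HB.pack f (GRing.isLinear.Build A X Y *:%R f f_linear).

(** The definition of a projective module lifts along surjections only. The
    image of a map, as a module of its own, extends this to maps that land in
    the image. *)
Section ImageModule.
Variables (A : nzRingType) (X Y : lmodType A) (g : {linear X -> Y}).

Definition image_pred : {pred Y} := fun y => `[< exists x, g x = y >].

Lemma image_submod_closed : submod_closed image_pred.
Proof.
split=> [|a u v]; first by apply/asboolP; exists 0; rewrite linear0.
move=> /asboolP[x <-] /asboolP[y <-]; apply/asboolP.
by exists (a *: x + y); rewrite linearP.
Qed.

HB.instance Definition _ :=
  GRing.isSubmodClosed.Build A Y image_pred image_submod_closed.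

Record image := Image { image_val : Y; _ : image_val \in image_pred }.

HB.instance Definition _ := [isSub for image_val].
HB.instance Definition _ := [Choice of image by <:].
HB.instance Definition _ := [SubChoice_isSubLmodule of image by <:].

End ImageModule.

Section Projective.
Variables (k : fieldType) (A : algType k).

Lemma projective_lift (P X Y : lmodType A) (g : {linear X -> Y})
    (f : {linear P -> Y}) :
  projective P -> (forall x, exists z, g z = f x) ->
  exists h : {linear P -> X}, forall x, g (h x) = f x.
Proof.
move=> projP fg.
have gI x : g x \in image_pred g by apply/asboolP; exists x.
have fI x : f x \in image_pred g by apply/asboolP; apply: fg.
pose g' x : image g := Image (gI x).
pose f' x : image g := Image (fI x).
have g'L : linear g'.
  by move=> a x y; apply: val_inj; rewrite [RHS]linearP /= linearP.
have f'L : linear f'.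
  by move=> a x y; apply: val_inj; rewrite [RHS]linearP /= linearP.
have [|h hE] := projP _ _ (linear_map g'L) (linear_map f'L).
  by case=> y /[dup] /asboolP[x gx] yI; exists x; apply: val_inj.
by exists h => x; have /(congr1 val) := hE x.
Qed.

(** A map out of a free module is lifted by lifting the images of the basis
    vectors. *)
Lemma row_projective n : projective ('rV[A]_n : lmodType A).
Proof.
move=> X Y g f gsurj.
have /choice[c cE] (i : 'I_n) : exists x, g x = f (delta_mx 0 i).
  exact: gsurj.
pose h (v : 'rV[A]_n) := \sum_i v 0 i *: c i.
have hL : linear h.
  move=> a u v; rewrite /h scaler_sumr -big_split; apply: eq_bigr => i _ /=.
  by rewrite !mxE scalerDl scalerA.
exists (linear_map hL) => v.
transitivity (f (\sum_i v 0 i *: delta_mx 0 i)); last by rewrite -row_sum_delta.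
rewrite linear_sum /= /h linear_sum; apply: eq_bigr => i _.
by rewrite !linearZ /= cE.
Qed.

End Projective.

Section Comparison.
Variables (k : fieldType) (A : algType k) (M : lmodType A).

(** The degree n component of a chain map P -> Q lifting the identity of M. The
    lower components are hidden under existential quantifiers, which spares a
    dependent choice of the whole chain map. *)
Fixpoint lifts_id (P Q : proj_resolution M) n :
    {linear res_mod P n -> res_mod Q n} -> Prop :=
  match n with
  | 0 => fun f => forall x, res_aug Q (f x) = res_aug P x
  | m.+1 => fun f => exists2 g : {linear res_mod P m -> res_mod Q m},
      lifts_id g & forall x, res_diff Q m (f x) = g (res_diff P m x)
  end.

Lemma res_diffK (P : proj_resolution M) i x :
  res_diff P i (res_diff P i.+1 x) = 0.
Proof. by apply/res_exactS; exists x. Qed.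

Lemma res_augK (P : proj_resolution M) x : res_aug P (res_diff P 0 x) = 0.
Proof. by apply/res_exact0; exists x. Qed.

Lemma lifts_idS P Q n (f : {linear res_mod P n -> res_mod Q n}) :
  lifts_id f -> exists2 g : {linear res_mod P n.+1 -> res_mod Q n.+1},
    lifts_id g & forall x, res_diff Q n (g x) = f (res_diff P n x).
Proof.
move=> fid.
suff [g gE] : exists g : {linear res_mod P n.+1 -> res_mod Q n.+1},
    forall x, res_diff Q n (g x) = (f \o res_diff P n) x.
  by exists g => //; exists f.
apply: projective_lift; first exact: res_projective.
move=> x /=; case: n f fid x => [|n] f /=.
  by move=> fid x; apply/res_exact0; rewrite fid res_augK.
by case=> g _ fg x; apply/res_exactS; rewrite fg res_diffK linear0.
Qed.

Lemma lifts_id_exists P Q n :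
  exists f : {linear res_mod P n -> res_mod Q n}, lifts_id f.
Proof.
elim: n => [|n [f fid]]; last by have [g] := lifts_idS fid; exists g.
apply: projective_lift; first exact: res_projective.
by move=> x; apply: res_aug_surj.
Qed.

Lemma lifts_id_comp P Q R n (f : {linear res_mod P n -> res_mod Q n})
    (g : {linear res_mod Q n -> res_mod R n}) :
  lifts_id f -> lifts_id g -> lifts_id (g \o f : {linear _ -> _}).
Proof.
elim: n f g => [|n IHn] f g /=; first by move=> fid gid x; rewrite gid fid.
case=> f' f'id ff' [g' g'id gg']; exists (g' \o f' : {linear _ -> _}).
  exact: IHn.
by move=> x /=; rewrite gg' ff'.
Qed.

Lemma lifts_id_id P n : lifts_id (idfun : {linear res_mod P n -> res_mod P n}).
Proof.
by elim: n => [|n IHn] //=; exists (idfun : {linear _ -> _}).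
Qed.

Lemma linear_subr (X Y : lmodType A) (f g : {linear X -> Y}) :
  linear (fun x => f x - g x).
Proof.
by move=> a x y; rewrite (linearP f) (linearP g) opprD addrACA scalerBr.
Qed.

Lemma linear_addr (X Y : lmodType A) (f g : {linear X -> Y}) :
  linear (fun x => f x + g x).
Proof. by move=> a x y; rewrite (linearP f) (linearP g) addrACA scalerDr. Qed.

Definition lin_sub (X Y : lmodType A) (f g : {linear X -> Y}) :
    {linear X -> Y} :=
  linear_map (linear_subr f g).

Definition lin_add (X Y : lmodType A) (f g : {linear X -> Y}) :
    {linear X -> Y} :=
  linear_map (linear_addr f g).

Definition is_cycle (P : proj_resolution M) n : res_mod P n -> Prop :=
  match n with
  | 0 => fun x => True
  | m.+1 => fun x => res_diff P m x = 0
  end.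

Lemma is_cycle_diff (P : proj_resolution M) n x : is_cycle (res_diff P n x).
Proof. by case: n x => //= n x; apply: res_diffK. Qed.

(** Two chain maps over the identity are homotopic. On cycles the homotopy
    formula f - g = d t + s d loses its last term, which leaves a statement
    about t alone that can be proved by induction on the degree. *)
Lemma homotopy_on_cycles P Q n (f g : {linear res_mod P n -> res_mod Q n}) :
  lifts_id f -> lifts_id g ->
  exists t : {linear res_mod P n -> res_mod Q n.+1},
    forall x, is_cycle x -> res_diff Q n (t x) = f x - g x.
Proof.
elim: n f g => [|n IHn] f g.
  move=> fid gid.
  have [||t tE] := @projective_lift _ _ _ _ _ (res_diff Q 0) (lin_sub f g).
  - exact: res_projective.
  - by move=> x; apply/res_exact0; rewrite linearB /= fid gid subrr.
  - by exists t => x _; rewrite tE.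
case=> f' f'id ff' [g' g'id gg'].
have [s sE] := IHn _ _ f'id g'id.
have sdE x : res_diff Q n (s (res_diff P n x)) =
    f' (res_diff P n x) - g' (res_diff P n x).
  exact/sE/is_cycle_diff.
have [||t tE] := @projective_lift _ _ _ _ _ (res_diff Q n.+1)
    (lin_sub (lin_sub f g) (s \o res_diff P n : {linear _ -> _})).
- exact: res_projective.
- move=> x; apply/res_exactS.
  by rewrite !linearB /= ff' gg' sdE subrr.
- by exists t => x /= x_cycle; rewrite tE /= x_cycle linear0 subr0.
Qed.

(** A cocycle kills the boundary part of a homotopy, so that homotopic maps
    pull it back to cocycles that differ by a coboundary. *)
Lemma cocycle_lifts_id (N : lmodType A) P Q j
    (f g : {linear res_mod P j.+1 -> res_mod Q j.+1})
    (z : {linear res_mod Q j.+1 -> N}) :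
  lifts_id f -> lifts_id g -> cocycle z ->
  exists s : {linear res_mod P j -> N},
    forall x, z (f x) = z (g x) + s (res_diff P j x).
Proof.
move=> [f' f'id ff'] [g' g'id gg'] zC.
have [s sE] := homotopy_on_cycles f'id g'id.
exists (z \o s : {linear _ -> _}) => x /=.
have /res_exactS[y yE] :
    res_diff Q j (f x - g x - s (res_diff P j x)) = 0.
  rewrite !linearB /= ff' gg' sE ?subrr //.
  exact: is_cycle_diff.
have -> : f x = g x + s (res_diff P j x) + res_diff Q j.+1 y.
  by rewrite yE -[f x - _ - _]addrA -opprD [RHS]addrC subrK.
by rewrite !linearD /= zC addr0.
Qed.

Variable N : lmodType A.

(** A basis of cocycles on Q is pulled back along a chain map f : P -> Q. It
    spans because f has a homotopy inverse g on one side, and is independent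
    because g is a homotopy inverse on the other side. *)
Lemma cohomology_dim_indep (P Q : proj_resolution M) j d :
  cohomology_dim N Q j.+1 d -> cohomology_dim N P j.+1 d.
Proof.
have [f fid] := lifts_id_exists P Q j.+1.
have [g gid] := lifts_id_exists Q P j.+1.
have [f' _ f'E] := lifts_idS fid; have [g' _ g'E] := lifts_idS gid.
have [f0 _ f0E] := fid; have [g0 _ g0E] := gid.
case=> z [zC zP].
pose w i : {linear res_mod P j.+1 -> N} := (z i \o f : {linear _ -> _}).
have wC i : cocycle (w i) by move=> x; rewrite /= -f'E zC.
exists w; split=> // u uC.
(* the coordinates of the class of u are those of its pull-back along g *)
have [|c [[b [b0 bE] cE] c_uniq]] := zP (u \o g : {linear _ -> _}).
  by move=> x; rewrite /= -g'E uC.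
have [s sE] :=
  cocycle_lifts_id (@lifts_id_id P j.+1) (lifts_id_comp fid gid) uC.
exists c; split.
  exists (lin_add (b \o f) (s \o res_diff P j)) => [|x].
    exists (lin_add (b0 \o f0) s) => x /=.
    by rewrite bE f0E.
  rewrite -[u x]/(u (idfun x)) sE /= addrA; congr (_ + _).
  exact: cE.
(* pulling an expression of u back along g gives one of its pull-back *)
move=> c' [b' [b'0 b'E] c'E]; apply: c_uniq.
have /choice[t tE] i : exists t : {linear res_mod Q j -> N},
    forall x, z i (f (g x)) = z i x + t (res_diff Q j x).
  by apply: (cocycle_lifts_id (lifts_id_comp gid fid) (@lifts_id_id Q j.+1)).
have tL : linear (fun x => \sum_i (c' 0 i)%:A *: t i x + b'0 (g0 x)).
  move=> a x y; rewrite (linearP g0) (linearP b'0) [RHS]/= scalerDr.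
  rewrite [RHS]addrACA.
  congr (_ + _); rewrite scaler_sumr -big_split; apply: eq_bigr => i _ /=.
  rewrite linearP scalerDr !scalerA; congr (_ *: _ + _).
  by rewrite -scalerAl -scalerAr mul1r mulr1.
exists (linear_map tL \o res_diff Q j : {linear _ -> _}).
  by exists (linear_map tL).
move=> x /=; rewrite c'E b'E g0E addrA -big_split; congr (_ + _) => /=.
by apply: eq_bigr => i _; rewrite tE scalerDr.
Qed.

End Comparison.

(** * The action of sl_2 on Poincare-Birkhoff-Witt normal forms *)

(** By bilinearity, operators that satisfy the bracket relations of e, h and f
    give a representation of sl_2. The matrix [[a1, a0], [a2, -a1]] acts by the
    combination with coefficients a0, a1 and a2; the coefficients on the right
    are the entries of a commutator of two such matrices. *)
Lemma bracket_of_combinations (k R : comNzRingType) (c : {rmorphism k -> R})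
    (E H F : R -> R) (a0 a1 a2 b0 b1 b2 : k) (v : R) :
    (forall m n, E (m + n) = E m + E n) ->
    (forall m n, H (m + n) = H m + H n) ->
    (forall m n, F (m + n) = F m + F n) ->
    (forall a m, E (c a * m) = c a * E m) ->
    (forall a m, H (c a * m) = c a * H m) ->
    (forall a m, F (c a * m) = c a * F m) ->
    (forall m, H (E m) = E (H m) + 2%:R * E m) ->
    (forall m, E (F m) = F (E m) + H m) ->
    (forall m, H (F m) = F (H m) - 2%:R * F m) ->
  let act x0 x1 x2 m := c x0 * E m + c x1 * H m + c x2 * F m in
  act a0 a1 a2 (act b0 b1 b2 v) - act b0 b1 b2 (act a0 a1 a2 v) =
  c (a1 * b0 + a0 * - b1 - (b1 * a0 + b0 * - a1)) * E v
  + c (a1 * b1 + a0 * b2 - (b1 * a1 + b0 * a2)) * H v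
  + c (a2 * b1 + - a1 * b2 - (b2 * a1 + - b1 * a2)) * F v.
Proof.
move=> ED HD FD EZ HZ FZ HE EF HF act; rewrite /act.
rewrite !(ED, HD, FD, EZ, HZ, FZ) !(HE, EF, HF).
rewrite !(rmorphB, rmorphD, rmorphM, rmorphN) /=; ring.
Qed.

Lemma combination_linearl (k R : comNzRingType) (c : {rmorphism k -> R})
    (a x0 x1 x2 y0 y1 y2 : k) (e h f : R) :
  c (a * x0 + y0) * e + c (a * x1 + y1) * h + c (a * x2 + y2) * f =
  c a * (c x0 * e + c x1 * h + c x2 * f) + (c y0 * e + c y1 * h + c y2 * f).
Proof. by rewrite !rmorphD !rmorphM /=; ring. Qed.

Lemma combination_linearr (R : comNzRingType) (a x0 x1 x2 e h f e' h' f' : R) :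
  x0 * (a * e + e') + x1 * (a * h + h') + x2 * (a * f + f') =
  a * (x0 * e + x1 * h + x2 * f) + (x0 * e' + x1 * h' + x2 * f').
Proof. by ring. Qed.

(** Normal forms are polynomials in three commuting variables, where
    x^i y^j z^l stands for e^i h^j f^l. The variable x is the innermost one of
    {poly {poly {poly k}}} and z the outermost. Left multiplications by e, h
    and f are then computed by
      h e^i = e^i (h + 2 i),
      f e^i = e^i f - i e^(i - 1) h - i (i - 1) e^(i - 1),
      f p(h) = p(h + 2) f.
    In terms of D = d/dx and of the shift T : y -> y + 2, the operators are
      e = x,  h = y + 2 x D,  f = z T - (y D + x D^2).
    The operators without z act on the coefficients of the powers of z; they are
    named after the generator with the prefix nf1. *)
Section NormalFormOperators.
Variable k : fieldType.

Notation pol1 := {poly {poly k}}.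
Notation pol2 := {poly {poly {poly k}}}.

Definition e_deriv (q : pol1) : pol1 := map_poly (@deriv k) q.
Definition h_shift (q : pol1) : pol1 := q \Po ('X + 2%:R).
Definition nf1_h (q : pol1) : pol1 := 'X * q + 2%:R * ('X%:P * e_deriv q).
Definition nf1_f (q : pol1) : pol1 :=
  'X * e_deriv q + 'X%:P * e_deriv (e_deriv q).

Lemma map_poly_MXaddC (R S : nzRingType) (f : {additive R -> S})
    (p : {poly R}) c :
  map_poly f (p * 'X + c%:P) = map_poly f p * 'X + (f c)%:P.
Proof.
apply/polyP => i; rewrite coef_map !coefD !coefMX !coefC coef_map.
by case: i => [|i] /=; rewrite ?add0r ?addr0.
Qed.

Lemma e_deriv_MXaddC q c : e_deriv (q * 'X + c%:P) = e_deriv q * 'X + c^`()%:P.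
Proof. exact: map_poly_MXaddC. Qed.

Lemma e_derivD q r : e_deriv (q + r) = e_deriv q + e_deriv r.
Proof. exact: raddfD. Qed.

Lemma e_derivMX q : e_deriv (q * 'X) = e_deriv q * 'X.
Proof. by have := e_deriv_MXaddC q 0; rewrite deriv0 !addr0. Qed.

Lemma e_derivMn q n : e_deriv (n%:R * q) = n%:R * e_deriv q.
Proof. by rewrite !mulr_natl [LHS]raddfMn. Qed.

Lemma e_derivCM p q : e_deriv (p%:P * q) = p^`()%:P * q + p%:P * e_deriv q.
Proof.
apply/polyP => i.
by rewrite /e_deriv coef_map /= coefCM derivM coefD !coefCM coef_map.
Qed.

Lemma e_deriv0 : e_deriv 0 = 0. Proof. exact: raddf0. Qed.

Lemma e_derivC c : e_deriv c%:P = c^`()%:P.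
Proof. by have := e_deriv_MXaddC 0 c; rewrite e_deriv0 !mul0r !add0r. Qed.

Lemma e_deriv_shift q : e_deriv (h_shift q) = h_shift (e_deriv q).
Proof.
rewrite /h_shift; elim/poly_ind: q => [|q c IHq].
  by rewrite comp_poly0 e_deriv0 comp_poly0.
rewrite e_deriv_MXaddC !comp_polyD !comp_polyM !comp_polyX !comp_polyC.
rewrite !e_derivD mulrDr e_derivD.
rewrite e_derivMX mulrC [in RHS]mulrC -IHq [_ * 2%:R]mulrC e_derivMn e_derivC.
ring.
Qed.

Lemma h_shift_MXaddC q c :
  h_shift (q * 'X + c%:P) = h_shift q * ('X + 2%:R) + c%:P.
Proof. by rewrite /h_shift comp_polyD comp_polyM comp_polyX comp_polyC. Qed.

Lemma nf1_h_MXaddC q c :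
  nf1_h (q * 'X + c%:P) = (nf1_h q + c%:P) * 'X + (2%:R * ('X * c^`()))%:P.
Proof. by rewrite /nf1_h e_deriv_MXaddC !rmorphM /= rmorph_nat; ring. Qed.

Lemma nf1_f_MXaddC q c :
  nf1_f (q * 'X + c%:P) = (nf1_f q + c^`()%:P) * 'X + ('X * c^`()^`())%:P.
Proof. by rewrite /nf1_f !e_deriv_MXaddC !rmorphM /=; ring. Qed.

Lemma nf1_hD q r : nf1_h (q + r) = nf1_h q + nf1_h r.
Proof. by rewrite /nf1_h e_derivD; ring. Qed.
Lemma nf1_fD q r : nf1_f (q + r) = nf1_f q + nf1_f r.
Proof. by rewrite /nf1_f !e_derivD; ring. Qed.

Lemma h_shiftD q r : h_shift (q + r) = h_shift q + h_shift r.
Proof. exact: comp_polyD. Qed.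

Lemma zmod_morphism_of_add (V W : zmodType) (f : V -> W) :
  {morph f : u v / u + v} -> zmod_morphism f.
Proof.
move=> fD u v.
have f0 : f 0 = 0 by apply: (addrI (f 0)); rewrite -fD !addr0.
by rewrite fD; congr (_ + _); apply: (addrI (f v)); rewrite -fD !subrr.
Qed.

HB.instance Definition _ := GRing.isZmodMorphism.Build pol1 pol1 h_shift
  (zmod_morphism_of_add h_shiftD).
HB.instance Definition _ := GRing.isZmodMorphism.Build pol1 pol1 nf1_h
  (zmod_morphism_of_add nf1_hD).
HB.instance Definition _ := GRing.isZmodMorphism.Build pol1 pol1 nf1_f
  (zmod_morphism_of_add nf1_fD).

Lemma h_shiftCM p q : h_shift (p%:P * q) = p%:P * h_shift q.
Proof. by rewrite /h_shift comp_polyM comp_polyC. Qed.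

Lemma h_shiftXM q : h_shift ('X * q) = ('X + 2%:R) * h_shift q.
Proof. by rewrite /h_shift comp_polyM comp_polyX. Qed.

Lemma e_derivXM q : e_deriv ('X * q) = 'X * e_deriv q.
Proof. by rewrite mulrC e_derivMX mulrC. Qed.

Lemma nf1_h_XM q : nf1_h ('X%:P * q) = 'X%:P * nf1_h q + 2%:R * ('X%:P * q).
Proof. by rewrite /nf1_h e_derivCM derivX; ring. Qed.

Lemma nf1_f_XM q : nf1_f ('X%:P * q) = 'X%:P * nf1_f q + nf1_h q.
Proof.
by rewrite /nf1_f /nf1_h !(e_derivCM, derivX, e_derivD) derivC; ring.
Qed.

Lemma nf1_h_shift q : nf1_h (h_shift q) = h_shift (nf1_h q) - 2%:R * h_shift q.
Proof.
have h_shift2 r : h_shift (2%:R * r) = 2%:R * h_shift r.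
  by rewrite !mulr_natl [LHS]raddfMn.
by rewrite /nf1_h h_shiftD h_shiftXM h_shift2 h_shiftCM e_deriv_shift; ring.
Qed.

Lemma nf1_h_nf1_f q : nf1_h (nf1_f q) = nf1_f (nf1_h q) - 2%:R * nf1_f q.
Proof.
rewrite /nf1_f /nf1_h !(e_derivCM, derivX, e_derivD, e_derivXM, e_derivMn).
by rewrite ?derivC; ring.
Qed.

Lemma e_derivZ (a : k) q : e_deriv (a%:P%:P * q) = a%:P%:P * e_deriv q.
Proof. by rewrite e_derivCM derivC mul0r add0r. Qed.
Lemma nf1_hCM (a : k) q : nf1_h (a%:P%:P * q) = a%:P%:P * nf1_h q.
Proof. by rewrite /nf1_h e_derivZ; ring. Qed.
Lemma nf1_fCM (a : k) q : nf1_f (a%:P%:P * q) = a%:P%:P * nf1_f q.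
Proof. by rewrite /nf1_f !e_derivZ; ring. Qed.

Definition nf_e (m : pol2) : pol2 := 'X%:P%:P * m.
Definition nf_h (m : pol2) : pol2 := map_poly nf1_h m.
Definition nf_f (m : pol2) : pol2 := map_poly h_shift m * 'X - map_poly nf1_f m.

Lemma coef_nf_e m i : (nf_e m)`_i = 'X%:P * m`_i.
Proof. exact: coefCM. Qed.
Lemma coef_nf_h m i : (nf_h m)`_i = nf1_h m`_i.
Proof. exact: coef_map. Qed.
Lemma coef_nf_f m i :
  (nf_f m)`_i = (if i is j.+1 then h_shift m`_j else 0) - nf1_f m`_i.
Proof.
by rewrite coefB coefMX; case: i => [|i] /=; rewrite !coef_map.
Qed.

Lemma nf_he m : nf_h (nf_e m) = nf_e (nf_h m) + 2%:R * nf_e m.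
Proof.
apply/polyP=> i; rewrite coefD mulr_natl coefMn !(coef_nf_h, coef_nf_e).
by rewrite nf1_h_XM mulr_natl.
Qed.

Lemma nf_ef m : nf_e (nf_f m) = nf_f (nf_e m) + nf_h m.
Proof.
apply/polyP=> i; rewrite coefD !(coef_nf_h, coef_nf_e, coef_nf_f) nf1_f_XM.
by case: i => [|i]; rewrite ?coef_nf_e ?h_shiftCM; ring.
Qed.

Lemma nf_hf m : nf_h (nf_f m) = nf_f (nf_h m) - 2%:R * nf_f m.
Proof.
apply/polyP=> i; rewrite coefB mulr_natl coefMn !(coef_nf_h, coef_nf_f).
rewrite (raddfB nf1_h) /= nf1_h_nf1_f -mulr_natl.
by case: i => [|i]; rewrite ?coef_nf_h ?nf1_h_shift ?raddf0; ring.
Qed.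

Definition nf_const (a : k) : pol2 := a%:P%:P%:P.

Lemma nf_constB : zmod_morphism nf_const.
Proof. by move=> a b; rewrite /nf_const !polyCB. Qed.
Lemma nf_const_monoid : monoid_morphism nf_const.
Proof. by split=> [|a b]; rewrite /nf_const ?polyC1 ?polyCM. Qed.
HB.instance Definition _ :=
  GRing.isZmodMorphism.Build k pol2 nf_const nf_constB.
HB.instance Definition _ :=
  GRing.isMonoidMorphism.Build k pol2 nf_const nf_const_monoid.

Lemma nf_e_linear a m n :
  nf_e (nf_const a * m + n) = nf_const a * nf_e m + nf_e n.
Proof. by rewrite /nf_e; ring. Qed.

Lemma nf_h_linear a m n :
  nf_h (nf_const a * m + n) = nf_const a * nf_h m + nf_h n.
Proof.
apply/polyP => i; rewrite !(coefD, coefCM, coef_nf_h).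
by rewrite nf1_hD nf1_hCM.
Qed.

Lemma nf_f_linear a m n :
  nf_f (nf_const a * m + n) = nf_const a * nf_f m + nf_f n.
Proof.
apply/polyP => i; rewrite !(coefD, coefCM, coef_nf_f).
rewrite nf1_fD nf1_fCM.
by case: i => [|i]; rewrite ?(coefD, coefCM) ?h_shiftD ?h_shiftCM; ring.
Qed.

(** The normal forms as a representation of sl_2. It separates the elements of
    the enveloping algebra: see [pbw_ehfK]. *)
Definition pbw_module : Type := pol2.
HB.instance Definition _ := GRing.Zmodule.on pbw_module.

Definition pbw_scale (a : k) (m : pbw_module) : pbw_module :=
  nf_const a * (m : pol2).

Lemma pbw_scaleA a b m : pbw_scale a (pbw_scale b m) = pbw_scale (a * b) m.
Proof. by rewrite /pbw_scale /nf_const !polyCM mulrA. Qed.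
Lemma pbw_scale1 : left_id 1 pbw_scale.
Proof. by move=> m; rewrite /pbw_scale /nf_const !polyC1 mul1r. Qed.
Lemma pbw_scaleDr : right_distributive pbw_scale +%R.
Proof. by move=> a u v; apply: mulrDr. Qed.
Lemma pbw_scaleDl m : {morph pbw_scale^~ m : a b / a + b}.
Proof. by move=> a b; rewrite /pbw_scale /nf_const !polyCD [LHS]mulrDl. Qed.

HB.instance Definition _ := GRing.Zmodule_isLmodule.Build k pbw_module
  pbw_scaleA pbw_scale1 pbw_scaleDr pbw_scaleDl.

Definition pbw_act (a : sl2 k) (m : pbw_module) : pbw_module :=
  nf_const (a 0 1) * nf_e m + nf_const (a 0 0) * nf_h m
  + nf_const (a 1 0) * nf_f m : pol2.

Lemma pbw_act_linearl m : linear (pbw_act^~ m).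
Proof.
move=> a x y; rewrite /pbw_act !mxE.
exact: (combination_linearl nf_const).
Qed.

Lemma pbw_act_linearr x : linear (pbw_act x).
Proof.
move=> a u v.
rewrite -[LHS]/(pbw_act x (nf_const a * (u : pol2) + v : pol2)).
rewrite /pbw_act nf_e_linear nf_h_linear nf_f_linear.
exact: combination_linearr.
Qed.

Lemma sl2_11 (x : sl2 k) : x 1 1 = - x 0 0.
Proof.
have /eqP := valP x; rewrite /mxtrace !big_ord_recl big_ord0 addr0 addrC.
by move/eqP; rewrite addr_eq0 => /eqP <-; congr (x _ _); apply: val_inj.
Qed.

Lemma sl2_lie_mxE (x y : sl2 k) (i j : 'I_2) : lie x y i j =
  x i 0 * y 0 j + x i 1 * y 1 j - (y i 0 * x 0 j + y i 1 * x 1 j).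
Proof.
rewrite !mxE !big_ord_recl !big_ord0 !addr0.
by have -> : lift ord0 ord0 = 1 :> 'I_2 by apply: val_inj.
Qed.

Lemma pbw_act_lie x y v :
  pbw_act (lie x y) v = pbw_act x (pbw_act y v) - pbw_act y (pbw_act x v).
Proof.
rewrite -[RHS]/((pbw_act x (pbw_act y v) : pol2) - pbw_act y (pbw_act x v)).
rewrite /pbw_act !sl2_lie_mxE.
rewrite (sl2_11 x) (sl2_11 y).
have HZ a m : nf_h (nf_const a * m) = nf_const a * nf_h m.
  by have := nf_h_linear a m 0; rewrite [nf_h 0]raddf0 !addr0.
have FZ a m : nf_f (nf_const a * m) = nf_const a * nf_f m.
  have F0 : nf_f 0 = 0.
    apply/polyP => i; rewrite coef_nf_f !coef0 raddf0 subr0.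
    by case: i => // i; rewrite coef0 raddf0.
  by have := nf_f_linear a m 0; rewrite F0 !addr0.
have EZ a m : nf_e (nf_const a * m) = nf_const a * nf_e m.
  by rewrite /nf_e mulrCA.
have cst1 m : nf_const 1 * m = m by rewrite /nf_const !polyC1 mul1r.
have ED m n : nf_e (m + n) = nf_e m + nf_e n by rewrite /nf_e mulrDr.
have HD m n : nf_h (m + n) = nf_h m + nf_h n.
  by have := nf_h_linear 1 m n; rewrite !cst1.
have FD m n : nf_f (m + n) = nf_f m + nf_f n.
  by have := nf_f_linear 1 m n; rewrite !cst1.
symmetry.
exact: (bracket_of_combinations (c := nf_const) _ _ _ _ _ _ _
  ED HD FD EZ HZ FZ nf_he nf_ef nf_hf).
Qed.

HB.instance Definition _ := Lmodule_isLieModule.Build k (sl2 k) pbw_module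
  pbw_act_linearl pbw_act_linearr pbw_act_lie.

End NormalFormOperators.

(** * The Poincare-Birkhoff-Witt basis of the enveloping algebra *)

Section PBW.
Variable k : fieldType.
Notation U := (envelope (sl2 k)).
Notation pol1 := {poly {poly k}}.
Notation pol2 := {poly {poly {poly k}}}.

Definition sl2E : sl2 k := Sl2 (sl2E_traceless k).
Definition sl2H : sl2 k := Sl2 (sl2H_traceless k).
Definition sl2F : sl2 k := Sl2 (sl2F_traceless k).

Lemma sl2_eqP (x y : sl2 k) :
  x 0 1 = y 0 1 -> x 0 0 = y 0 0 -> x 1 0 = y 1 0 -> x = y.
Proof.
move=> x01 x00 x10; apply: val_inj; apply/matrixP=> i j /=.
have I2 (l : 'I_2) : l = 0 \/ l = 1.
  by case: l => [[|[|[]]]] // ll; [left | right]; apply: val_inj.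
by case: (I2 i) => ->; case: (I2 j) => ->; rewrite ?sl2_11 ?x00.
Qed.

Lemma lie_HE : lie sl2H sl2E = sl2E *+ 2.
Proof.
by apply: sl2_eqP; rewrite mulr2n sl2_lie_mxE !mxE /=; ring.
Qed.
Lemma lie_HF : lie sl2H sl2F = - (sl2F *+ 2).
Proof.
by apply: sl2_eqP; rewrite mulr2n sl2_lie_mxE !mxE /=; ring.
Qed.
Lemma lie_EF : lie sl2E sl2F = sl2H.
Proof.
by apply: sl2_eqP; rewrite sl2_lie_mxE !mxE /=; ring.
Qed.

Definition eU : U := env_in sl2E.
Definition hU : U := env_in sl2H.
Definition fU : U := env_in sl2F.

Lemma hUeU : hU * eU = eU * hU + 2%:R * eU.
Proof.
have := env_in_lie sl2H sl2E; rewrite lie_HE raddfMn /= mulr_natl => ->.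
by rewrite addrC subrK.
Qed.
Lemma eUfU : eU * fU = fU * eU + hU.
Proof.
have := env_in_lie sl2E sl2F; rewrite lie_EF -/hU => ->.
by rewrite addrC subrK.
Qed.
Lemma fUhU : fU * hU = (hU + 2%:R) * fU.
Proof.
have := env_in_lie sl2H sl2F; rewrite lie_HF raddfN raddfMn /= -/hU -/fU.
move=> /eqP; rewrite eqr_oppLR opprB => /eqP fE.
by rewrite mulrDl mulr_natl fE addrC subrK.
Qed.

(** Evaluation of normal forms in one, two and three variables. Each variable is
    substituted on the right of the coefficients, which puts the factors in the
    order e, h, f. *)
Definition pbw_e (p : {poly k}) : U := horner_alg eU p.

Lemma pbw_eD p q : pbw_e (p + q) = pbw_e p + pbw_e q.
Proof. exact: rmorphD. Qed.

HB.instance Definition _ := GRing.isZmodMorphism.Build {poly k} U pbw_e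
  (zmod_morphism_of_add pbw_eD).

Definition pbw_eh (q : pol1) : U := (map_poly pbw_e q).[hU].

Lemma pbw_ehD q r : pbw_eh (q + r) = pbw_eh q + pbw_eh r.
Proof. by rewrite /pbw_eh raddfD hornerD. Qed.

HB.instance Definition _ := GRing.isZmodMorphism.Build pol1 U pbw_eh
  (zmod_morphism_of_add pbw_ehD).

Definition pbw_ehf (m : pol2) : U := (map_poly pbw_eh m).[fU].

Lemma pbw_ehfD q r : pbw_ehf (q + r) = pbw_ehf q + pbw_ehf r.
Proof. by rewrite /pbw_ehf raddfD hornerD. Qed.

HB.instance Definition _ := GRing.isZmodMorphism.Build pol2 U pbw_ehf
  (zmod_morphism_of_add pbw_ehfD).

Lemma pbw_e_MXaddC p (c : k) : pbw_e (p * 'X + c%:P) = pbw_e p * eU + c%:A.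
Proof. by rewrite /pbw_e rmorphD rmorphM /= horner_algX horner_algC. Qed.

Lemma pbw_eh_MXaddC q c : pbw_eh (q * 'X + c%:P) = pbw_eh q * hU + pbw_e c.
Proof. by rewrite /pbw_eh map_poly_MXaddC hornerMXaddC. Qed.

Lemma pbw_ehf_MXaddC m c : pbw_ehf (m * 'X + c%:P) = pbw_ehf m * fU + pbw_eh c.
Proof. by rewrite /pbw_ehf map_poly_MXaddC hornerMXaddC. Qed.

Lemma pbw_e0 : pbw_e 0 = 0. Proof. exact: raddf0. Qed.
Lemma pbw_eh0 : pbw_eh 0 = 0. Proof. exact: raddf0. Qed.
Lemma pbw_ehf0 : pbw_ehf 0 = 0. Proof. exact: raddf0. Qed.
Lemma pbw_ehC c : pbw_eh c%:P = pbw_e c.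
Proof. by have := pbw_eh_MXaddC 0 c; rewrite pbw_eh0 !mul0r !add0r. Qed.
Lemma pbw_ehfC c : pbw_ehf c%:P = pbw_eh c.
Proof. by have := pbw_ehf_MXaddC 0 c; rewrite pbw_ehf0 !mul0r !add0r. Qed.
Lemma pbw_ehMX q : pbw_eh (q * 'X) = pbw_eh q * hU.
Proof. by have := pbw_eh_MXaddC q 0; rewrite pbw_e0 !addr0. Qed.
Lemma pbw_ehfMX q : pbw_ehf (q * 'X) = pbw_ehf q * fU.
Proof. by have := pbw_ehf_MXaddC q 0; rewrite pbw_eh0 !addr0. Qed.

Lemma pbw_e_XM p : pbw_e ('X * p) = eU * pbw_e p.
Proof. by rewrite /pbw_e rmorphM /= horner_algX. Qed.
Lemma pbw_e_MX p : pbw_e (p * 'X) = pbw_e p * eU.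
Proof. by rewrite /pbw_e rmorphM /= horner_algX. Qed.
Lemma pbw_eC c : pbw_e c%:P = c%:A. Proof. exact: horner_algC. Qed.
Lemma pbw_en n p : pbw_e (n%:R * p) = n%:R * pbw_e p.
Proof. by rewrite /pbw_e rmorphM rmorph_nat. Qed.

Lemma alg_commutes (c : k) (u : U) : c%:A * u = u * c%:A.
Proof. by rewrite -scalerAl -scalerAr mul1r mulr1. Qed.

Lemma nat_commutes n (u : U) : n%:R * u = u * n%:R.
Proof. by rewrite mulr_natl mulr_natr. Qed.

(** The induction steps that move h and f to the right of a polynomial in e. The
    element t stands for 2 and a for a scalar: left as variables, they are
    not unfolded into sums and products when the sides are expanded. *)
Section Steps.
Variables (R : nzRingType) (e h f t : R).
Hypothesis heE : h * e = e * h + t * e.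
Hypothesis efE : e * f = f * e + h.
Hypothesis tC : forall u, t * u = u * t.

Lemma commute_h_step P B a : h * P = P * h + t * B -> a * h = h * a ->
  h * (P * e + a) = (P * e + a) * h + t * (B * e + P * e).
Proof.
move=> hP aC; rewrite mulrDr mulrA hP !mulrDl mulrDr !mulrA aC.
rewrite -[P * e * h]mulrA.
have -> : P * h * e = P * (e * h) + t * P * e.
  by rewrite -mulrA heE mulrDr (tC P) !mulrA.
by rewrite -!mulrA [LHS](AC (2*1*1) ((1*4)*(3*2))).
Qed.

Lemma commute_f_step P A B a :
    f * P + (A * h + B) = P * f -> a * f = f * a ->
  f * (P * e + a) + ((A * e + P) * h + (B * e + (A * e * t))) = (P * e + a) * f.
Proof.
move=> fP aC.
have AhE : A * h * e = A * e * h + A * e * t.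
  by rewrite -mulrA heE mulrDr (tC e) !mulrA.
have -> : (P * e + a) * f = (f * P + (A * h + B)) * e + P * h + a * f.
  by rewrite fP !mulrDl -!mulrA efE mulrDr.
rewrite aC !mulrDr !mulrDl AhE !mulrA.
by rewrite [LHS](AC ((1*1)*((1*1)*(1*1))) (((1*((3*6)*5))*4)*2)).
Qed.
End Steps.

Lemma derivMXaddC (p : {poly k}) c : (p * 'X + c%:P)^`() = p^`() * 'X + p.
Proof. by rewrite derivD derivC addr0 derivM derivX mulr1. Qed.

(** The bracket with h is the derivation 2 x d/dx of the polynomials in e. *)
Lemma hU_pbw_e p : hU * pbw_e p = pbw_e p * hU + 2%:R * pbw_e (p^`() * 'X).
Proof.
elim/poly_ind: p => [|p c IHp].
  by rewrite deriv0 mul0r pbw_e0 !(mulr0, mul0r) addr0.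
rewrite derivMXaddC pbw_e_MXaddC [(_ + p) * 'X]mulrDl pbw_eD.
rewrite (pbw_e_MX (_ * _)) (pbw_e_MX p).
exact: (commute_h_step hUeU (nat_commutes 2) IHp (alg_commutes c hU)).
Qed.

(** From [f, e^i] = - i e^(i - 1) h - i (i - 1) e^(i - 1). *)
Lemma fU_pbw_e p :
  fU * pbw_e p + (pbw_e p^`() * hU + pbw_e (p^`()^`() * 'X)) = pbw_e p * fU.
Proof.
elim/poly_ind: p => [|p c IHp].
  by rewrite !deriv0 mul0r pbw_e0 !(mulr0, mul0r) !addr0.
have d2 : (p^`() * 'X + p)^`() * 'X = p^`()^`() * 'X * 'X + (p^`() * 'X) * 2%:R.
  by rewrite derivD derivM derivX; ring.
rewrite derivMXaddC d2 pbw_e_MXaddC.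
have -> : pbw_e (p^`()^`() * 'X * 'X + (p^`() * 'X) * 2%:R) =
   pbw_e (p^`()^`() * 'X) * eU + pbw_e p^`() * eU * 2%:R.
  rewrite pbw_eD (pbw_e_MX (_ * _)).
  by rewrite [p^`() * 'X * _]mulrC pbw_en (pbw_e_MX p^`()) nat_commutes.
rewrite pbw_eD pbw_e_MX.
exact: (commute_f_step hUeU eUfU (nat_commutes 2) IHp (alg_commutes c fU)).
Qed.

(** From here on, the statements say that the evaluation of normal forms
    intertwines the operators on polynomials with left multiplication. *)
Lemma hU_pbw_eh q : hU * pbw_eh q = pbw_eh (nf1_h q).
Proof.
elim/poly_ind: q => [|q c IHq].
  by rewrite (raddf0 (@nf1_h k)) pbw_eh0 mulr0.
rewrite nf1_h_MXaddC !pbw_eh_MXaddC pbw_ehD pbw_ehC mulrDr.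
rewrite [hU * (_ * _)]mulrA IHq hU_pbw_e pbw_en.
by rewrite ['X * _]mulrC [(_ + pbw_e c) * hU]mulrDl addrA.
Qed.

Lemma fU_pbw_eh q : fU * pbw_eh q + pbw_eh (nf1_f q) = pbw_eh (h_shift q) * fU.
Proof.
elim/poly_ind: q => [|q c IHq].
  rewrite (raddf0 (@nf1_f k)) (raddf0 (@h_shift k)) pbw_eh0.
  by rewrite mulr0 mul0r addr0.
have h_shiftE : pbw_eh (h_shift (q * 'X + c%:P)) =
    pbw_eh (h_shift q) * (hU + 2%:R) + pbw_e c.
  have -> : h_shift (q * 'X + c%:P) =
      h_shift q * 'X + (h_shift q + h_shift q + c%:P).
    by rewrite h_shift_MXaddC; ring.
  by rewrite !pbw_ehD pbw_ehMX pbw_ehC addrA mulrDr mulr_natr mulr2n.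
rewrite h_shiftE nf1_f_MXaddC !pbw_eh_MXaddC (pbw_ehD (nf1_f q)) pbw_ehC.
rewrite [RHS]mulrDl -mulrA -fUhU [pbw_eh (h_shift q) * _]mulrA -IHq -fU_pbw_e.
rewrite mulrDr [(fU * pbw_eh q + _) * _]mulrDl.
rewrite [(pbw_eh (nf1_f q) + _) * _]mulrDl.
by rewrite !mulrA ['X * _]mulrC [LHS](AC (2*(2*1)) ((1*3)*(2*(4*5)))).
Qed.

Lemma eU_pbw_eh q : eU * pbw_eh q = pbw_eh ('X%:P * q).
Proof.
elim/poly_ind: q => [|q c IHq]; first by rewrite !mulr0 pbw_eh0 mulr0.
rewrite mulrDr -polyCM mulrA !pbw_eh_MXaddC pbw_e_XM -IHq mulrDr.
by rewrite mulrA.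
Qed.

Lemma eU_pbw_ehf m : eU * pbw_ehf m = pbw_ehf (nf_e m).
Proof.
rewrite /nf_e.
elim/poly_ind: m => [|q c IHq]; first by rewrite !mulr0 pbw_ehf0 mulr0.
by rewrite mulrDr -polyCM mulrA !pbw_ehf_MXaddC -eU_pbw_eh -IHq mulrDr mulrA.
Qed.

Lemma hU_pbw_ehf m : hU * pbw_ehf m = pbw_ehf (nf_h m).
Proof.
rewrite /nf_h.
elim/poly_ind: m => [|q c IHq]; first by rewrite map_poly0 pbw_ehf0 mulr0.
by rewrite map_poly_MXaddC !pbw_ehf_MXaddC mulrDr mulrA IHq hU_pbw_eh.
Qed.

Lemma fU_pbw_ehf m : fU * pbw_ehf m = pbw_ehf (nf_f m).
Proof.
rewrite /nf_f [RHS]raddfB /=.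
apply/eqP; rewrite eq_sym subr_eq; apply/eqP; rewrite pbw_ehfMX.
elim/poly_ind: m => [|q c IHq].
  by rewrite !(map_poly0, pbw_ehf0) mulr0 mul0r addr0.
rewrite !map_poly_MXaddC !pbw_ehf_MXaddC mulrDr !mulrDl -fU_pbw_eh mulrA IHq.
by rewrite mulrDl addrACA.
Qed.

Lemma algU_pbw_eh (c : k) q : c%:A * pbw_eh q = pbw_eh (c%:P%:P * q).
Proof.
elim/poly_ind: q => [|q d IHq]; first by rewrite !(mulr0, pbw_eh0).
rewrite mulrDr -polyCM mulrA !pbw_eh_MXaddC -IHq mulrDr mulrA; congr (_ + _).
by rewrite /pbw_e rmorphM /= horner_algC.
Qed.

Lemma algU_pbw_ehf (c : k) m : c%:A * pbw_ehf m = pbw_ehf (nf_const c * m).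
Proof.
elim/poly_ind: m => [|q d IHq]; first by rewrite !(mulr0, pbw_ehf0).
by rewrite mulrDr -polyCM mulrA !pbw_ehf_MXaddC -algU_pbw_eh -IHq mulrDr mulrA.
Qed.

End PBW.

Section PBW2.
Variable k : fieldType.
Local Open Scope quotient_scope.
Notation U := (envelope (sl2 k)).
Notation pol1 := {poly {poly k}}.
Notation pol2 := {poly {poly {poly k}}}.
Notation eU := (@eU k).
Notation hU := (@hU k).
Notation fU := (@fU k).
Notation M := (env_module (pbw_module k)).

Lemma combination_basisE (R : comNzRingType) (c : {rmorphism k -> R})
    (e h f : R) :
  [/\ c 1 * e + c 0 * h + c 0 * f = e, c 0 * e + c 1 * h + c 0 * f = h
    & c 0 * e + c 0 * h + c 1 * f = f].
Proof. by rewrite rmorph0 rmorph1 !mul1r !mul0r !(add0r, addr0). Qed.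

Lemma eU_act (m : pol2) : eU *: (m : M) = nf_e m :> pol2.
Proof.
rewrite [LHS]env_module_inE -[LHS]/(pbw_act (sl2E k) m) /pbw_act !mxE.
by have [] := combination_basisE (@nf_const k) (nf_e m) (nf_h m) (nf_f m).
Qed.
Lemma hU_act (m : pol2) : hU *: (m : M) = nf_h m :> pol2.
Proof.
rewrite [LHS]env_module_inE -[LHS]/(pbw_act (sl2H k) m) /pbw_act !mxE !subr0.
by have [] := combination_basisE (@nf_const k) (nf_e m) (nf_h m) (nf_f m).
Qed.
Lemma fU_act (m : pol2) : fU *: (m : M) = nf_f m :> pol2.
Proof.
rewrite [LHS]env_module_inE -[LHS]/(pbw_act (sl2F k) m) /pbw_act !mxE.
by have [] := combination_basisE (@nf_const k) (nf_e m) (nf_h m) (nf_f m).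
Qed.
Lemma algU_act c (m : pol2) : (c%:A : U) *: (m : M) = nf_const c * m :> pol2.
Proof. by rewrite [LHS]env_module_algE. Qed.

(** The three lemmas that follow say that e^i h^j f^l sends 1 to the normal form
    x^i y^j z^l. The hypotheses on v hold for polynomials in y and z, and in z
    alone: these are the vectors on which h and f merely multiply. *)
Lemma pbw_e_act p (m : pol2) : pbw_e p *: (m : M) = p%:P%:P * m :> pol2.
Proof.
elim/poly_ind: p m => [|p c IHp] m.
  by rewrite pbw_e0 -[LHS]/(0 *: (m : M)) scale0r !polyC0 mul0r.
rewrite pbw_e_MXaddC [LHS]scalerDl -scalerA.
rewrite -[LHS]/((pbw_e p *: (eU *: (m : M)) : pol2) + c%:A *: (m : M)).
rewrite IHp eU_act algU_act /nf_e /nf_const !polyCD !polyCM; ring.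
Qed.

Lemma nf1_f_dx0 (q : pol1) : e_deriv q = 0 -> nf1_f q = 0.
Proof. by rewrite /nf1_f => ->; rewrite e_deriv0 !mulr0 addr0. Qed.

Lemma pbw_eh_act q (v : pol2) : (forall i, e_deriv v`_i = 0) ->
  pbw_eh q *: (v : M) = q%:P * v :> pol2.
Proof.
elim/poly_ind: q v => [|q c IHq] v v_dx.
  by rewrite pbw_eh0 -[LHS]/(0 *: (v : M)) scale0r polyC0 mul0r.
have hv : nf_h v = 'X%:P * v.
  by apply/polyP=> i; rewrite coef_nf_h coefCM /nf1_h v_dx !mulr0 addr0.
rewrite pbw_eh_MXaddC [LHS]scalerDl -scalerA.
rewrite -[LHS]/((pbw_eh q *: (hU *: (v : M)) : pol2) + pbw_e c *: (v : M)).
rewrite hU_act hv IHq ?pbw_e_act => [|i]; last first.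
  by rewrite coefCM e_derivXM v_dx mulr0.
by rewrite polyCD polyCM mulrDl mulrA.
Qed.

Lemma pbw_ehf_act m (v : pol2) :
    (forall i, e_deriv v`_i = 0) -> (forall i, h_shift v`_i = v`_i) ->
  pbw_ehf m *: (v : M) = m * v :> pol2.
Proof.
elim/poly_ind: m v => [|m c IHm] v v_dx v_shift.
  by rewrite pbw_ehf0 -[LHS]/(0 *: (v : M)) scale0r mul0r.
have fv : nf_f v = 'X * v.
  apply/polyP=> i; rewrite coef_nf_f coefXM nf1_f_dx0 // subr0.
  by case: i => //= i; rewrite v_shift.
rewrite pbw_ehf_MXaddC [LHS]scalerDl -scalerA.
rewrite -[LHS]/((pbw_ehf m *: (fU *: (v : M)) : pol2) + pbw_eh c *: (v : M)).
rewrite fU_act fv IHm ?pbw_eh_act // => [|i|i].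
- by rewrite mulrDl mulrA.
- by rewrite coefXM; case: i => [|i] //=; rewrite e_deriv0.
- by rewrite coefXM; case: i => [|i] //=; apply: (raddf0 (@h_shift k)).
Qed.

Lemma pbw_ehfK m : pbw_ehf m *: ((1 : pol2) : M) = m :> pol2.
Proof.
rewrite pbw_ehf_act ?mulr1 // => i; rewrite coef1; case: eqP => _ /=.
- by rewrite -polyC1 e_derivC -[1]/(1%:P) derivC.
- exact: e_deriv0.
- by rewrite /h_shift -polyC1 comp_polyC.
- exact: (raddf0 (@h_shift k)).
Qed.

Lemma pbw_ehf_inj : injective (@pbw_ehf k).
Proof. by move=> m n mn; rewrite -[m]pbw_ehfK mn [LHS]pbw_ehfK. Qed.

(** The evaluated normal forms are stable under left multiplication by the
    generators, hence by every element of U, and they contain 1. *)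
Lemma pbw_ehf_surj (u : U) : exists m, pbw_ehf m = u.
Proof.
pose cls (s : env_term k (sl2 k)) : U := \pi_(envelope (sl2 k)) s.
have clsM s t : cls (EMul s t) = cls s * cls t by rewrite [RHS]cls_mul.
have clsD s t : cls (EAdd s t) = cls s + cls t by rewrite [RHS]cls_add.
(* stability under left multiplication, by induction on an expression *)
suff main s m : exists m', pbw_ehf m' = cls s * pbw_ehf m.
  elim/envP: u => s; have [m mE] := main s 1; exists m; rewrite mE.
  have -> : pbw_ehf 1 = 1 :> U.
    by rewrite -polyC1 pbw_ehfC -polyC1 pbw_ehC -polyC1 pbw_eC scale1r.
  by rewrite mulr1.
elim: s m => [x|c|s IHs t IHt|s IHs t IHt] m.
- exists (nf_const (x 0 1) * nf_e m
    + (nf_const (x 0 0) * nf_h m + nf_const (x 1 0) * nf_f m)).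
  rewrite !pbw_ehfD -!algU_pbw_ehf -eU_pbw_ehf -hU_pbw_ehf -fU_pbw_ehf.
  rewrite -[cls _]/(env_in x) [in RHS](sl2_coordE x) !big_ord_recl big_ord0.
  rewrite addr0 !linearD !linearZ /= !mulrDl -!scalerAl.
  rewrite ![1 * (_ * _)]mul1r /sl2_coord !(tnth_nth 0) /=.
  by rewrite -[Sl2 (sl2E_traceless k)]/(sl2E k).
- exists (nf_const c * m); rewrite -algU_pbw_ehf; congr (_ * _).
  exact: (env_mul1r (cls (EConst c))).
- have [ms msE] := IHs m; have [mt mtE] := IHt m.
  by exists (ms + mt); rewrite pbw_ehfD msE mtE clsD mulrDl.
- have [mt mtE] := IHt m; have [ms msE] := IHs mt.
  by exists ms; rewrite msE mtE clsM mulrA.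
Qed.

End PBW2.

(** * The Chevalley-Eilenberg resolution and third Ext groups *)

(** The computations in the complex need only the bracket relations. As above,
    t stands for 2. *)
Section KoszulIdentities.
Variables (R : nzRingType) (e h f t : R).
Hypothesis heE : h * e = e * h + t * e.
Hypothesis efE : e * f = f * e + h.
Hypothesis fhE : f * h = (h + t) * f.
Hypothesis tC : forall u, t * u = u * t.

(** A 1-chain (a, b, c), written modulo right multiples of f and of h - 2, has a
    boundary in which these multiples are separated again. *)
Lemma koszul1_identity P Q B w v c :
  (P + Q * (h - t) + w * f) * e + (B + v * f + w) * h + c * f
  = (P * e + (Q * e + B) * h) + (w * e + v * (h + t) + c) * f.
Proof.
have he : (h - t) * e = e * h by rewrite mulrBl heE addrK.
rewrite !mulrDl -[Q * (h - t) * e]mulrA he -[w * f * e]mulrA.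
rewrite -[v * f * h]mulrA fhE -[w * e * f]mulrA efE.
rewrite !mulrDl !mulrDr !mulrDl !mulrA.
by rewrite [LHS](AC (3*(1*2*1)*1) ((1*(2*4))*((3*7)*(5*6)*8))).
Qed.

Lemma mul_f_sub u : u * f * (t - h) = - (u * h * f).
Proof. by rewrite -!mulrA mulrBr fhE mulrDl -tC opprD addrC addrNK mulrN. Qed.

(** If x = Q + u f is the first entry of a 2-cycle, its other entries are
    determined by u up to terms that are controlled by Q. *)
Lemma koszul2_identity Q u y z :
    (Q + u * f) * (t - h) - y * f = 0 ->
    (Q + u * f) * e - y - z * f = 0 ->
  Q * (t - h) + (- (Q * e + (u * e - z) * f)) * f = 0 /\
  y = Q * e + (u * e - z) * f - u * h.
Proof.
move=> eq1 eq2.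
have yE : y = Q * e + (u * e - z) * f - u * h.
  move/eqP: eq2; rewrite -addrA -opprD subr_eq0 => /eqP ye.
  have -> : y = (Q + u * f) * e - z * f by rewrite ye addrK.
  rewrite mulrDl mulrBl -!mulrA efE !mulrDr.
  by rewrite [RHS]addrC !addrA [in RHS](ACl (2*3*4*1*5)) /= addrK.
split=> //; rewrite -eq1 yE; set W := Q * e + _.
by rewrite mulNr [in RHS]mulrDl mul_f_sub [(W - _) * f]mulrBl opprB addrA subrK.
Qed.

Lemma koszul_d1d2 a b c :
  (a * (t - h) - b * f) * e + (a * e - b - c * f) * h
  + (b * e + c * (h + t)) * f = 0.
Proof.
have := koszul1_identity 0 (- a) (a * e) (- b) (- c) (b * e + c * (h + t)).
rewrite add0r mul0r add0r !mulNr addNr mul0r add0r.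
have -> : - (b * e) - c * (h + t) + (b * e + c * (h + t)) = 0.
  by rewrite -opprD addNr.
by rewrite mul0r -mulrN opprB [a * e - c * f - b]addrAC.
Qed.

Lemma koszul_d2d3 u : [/\ u * f * (t - h) - (- (u * h)) * f = 0,
  u * f * e - (- (u * h)) - u * e * f = 0
  & - (u * h) * e + u * e * (h + t) = 0].
Proof.
split.
- by rewrite mul_f_sub mulNr opprK addNr.
- by rewrite opprK -!mulrA efE -mulrDr subrr.
- by rewrite mulNr -!mulrA heE (tC e) -mulrDr addNr.
Qed.

End KoszulIdentities.

Section Decomposition.
Variable k : fieldType.
Notation U := (envelope (sl2 k)).
Notation pol1 := {poly {poly k}}.
Notation eU := (@eU k).
Notation hU := (@hU k).
Notation fU := (@fU k).

(** Together with [f_indep]: U is the direct sum of the subalgebra generated by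
    e and h and of the left ideal U f, and right multiplication by f is
    injective. *)
Lemma f_decomp (u : U) : exists q w, u = pbw_eh q + w * fU.
Proof.
have [m <-] := pbw_ehf_surj u; elim/poly_ind: m => [|m c _].
  by exists 0, 0; rewrite mul0r addr0 pbw_ehf0 pbw_eh0.
by exists c, (pbw_ehf m); rewrite pbw_ehf_MXaddC addrC.
Qed.

Lemma MXaddC_eq0 (R : nzRingType) (p : {poly R}) c :
  p * 'X + c%:P = 0 -> p = 0 /\ c = 0.
Proof.
move=> /polyP pc; split; last first.
  by have := pc 0; rewrite coefD coefMX coefC coef0 add0r.
apply/polyP => i; have := pc i.+1.
by rewrite coefD coefMX coefC !coef0 addr0.
Qed.

Lemma f_indep q (w : U) : pbw_eh q + w * fU = 0 -> q = 0 /\ w = 0.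
Proof.
have [m <-] := pbw_ehf_surj w; rewrite addrC -pbw_ehf_MXaddC -(pbw_ehf0 k).
by move=> /pbw_ehf_inj/MXaddC_eq0[-> ->]; rewrite pbw_ehf0.
Qed.

Lemma pbw_eh_MXsub2 (q : pol1) :
  pbw_eh (q * ('X - (2%:R : {poly k})%:P)) = pbw_eh q * (hU - 2%:R).
Proof.
have -> : q * ('X - (2%:R : {poly k})%:P) = q * 'X - (q + q).
  by rewrite mulrBr polyCMn mulr_natr mulr2n.
rewrite [LHS]raddfB /= pbw_ehD pbw_ehMX mulrBr mulr_natr.
by rewrite mulr2n.
Qed.

(** Division by h - 2: the first coordinate of d (e /\ h) is 2 - h. *)
Lemma h_decomp (q : pol1) : exists p q',
  pbw_eh q = pbw_e p + pbw_eh q' * (hU - 2%:R).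
Proof.
have /factor_theorem[q' q'E] : root (q - q.[2%:R]%:P) 2%:R.
  by rewrite /root hornerD hornerN hornerC subrr.
exists q.[2%:R], q'; rewrite -pbw_eh_MXsub2 -q'E -pbw_ehC -pbw_ehD.
by rewrite addrC subrK.
Qed.

Lemma pbw_eh_mule (q : pol1) : exists q', pbw_eh q * eU = pbw_eh q'.
Proof.
elim/poly_ind: q => [|q c [q' IHq]]; first by exists 0; rewrite pbw_eh0 mul0r.
exists (q' * 'X + (q' + q') + (c * 'X)%:P).
rewrite !pbw_ehD !pbw_ehMX !pbw_ehC pbw_e_MX -IHq mulrDl; congr (_ + _).
by rewrite -mulrA hUeU mulrDr mulr_natl mulr2n !mulrDr mulrA.
Qed.

(** Boundaries of e /\ f and h /\ f remove the multiples of f from a and b, and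
    boundaries of e /\ h remove the multiples of h - 2 from a. What is left of
    the cycle condition is a relation in normal form, so every term of it
    vanishes. *)
Lemma koszul_exact1 (a b c : U) : a * eU + b * hU + c * fU = 0 ->
  exists w1 w2 w3, [/\ a = w1 * (2%:R - hU) - w2 * fU,
    b = w1 * eU - w2 - w3 * fU & c = w2 * eU + w3 * (hU + 2%:R)].
Proof.
have [qa [wa aE]] := f_decomp a; have [p [q qaE]] := h_decomp qa.
have [qb [wb bE]] := f_decomp (b - wa).
have {}bE : b = pbw_eh qb + wb * fU + wa by rewrite -bE subrK.
rewrite aE qaE bE (koszul1_identity (hUeU k) (eUfU k) (fUhU k)).
have [q' q'E] := pbw_eh_mule q.
rewrite q'E -pbw_ehD -pbw_e_MX -pbw_ehMX -pbw_ehC -pbw_ehD.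
move=> /f_indep[+ cE]; rewrite addrC => /MXaddC_eq0[qb0 p0].
have {}p0 : p = 0 by have [] := @MXaddC_eq0 k p 0; rewrite ?addr0.
exists (- pbw_eh q), (- wa), (- wb); split.
- by rewrite p0 pbw_e0 add0r mulNr -mulrN opprB mulNr opprK.
- have -> : pbw_eh qb = - (pbw_eh q * eU).
    by apply/eqP; rewrite -addr_eq0 q'E -pbw_ehD addrC qb0 pbw_eh0.
  by rewrite !mulNr !opprK addrAC.
- by move/eqP: cE; rewrite addrC addr_eq0 opprD !mulNr => /eqP.
Qed.

(** Subtracting the boundary of u removes the multiples of f from x. The cycle
    condition then forces x to vanish, since h - 2 is not a zero divisor
    in k[e, h]. The conditions on two of the three coordinates suffice. *)
Lemma koszul_exact2 (x y z : U) :
    x * (2%:R - hU) - y * fU = 0 -> x * eU - y - z * fU = 0 ->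
  exists u, [/\ x = u * fU, y = - (u * hU) & z = u * eU].
Proof.
have [q [u ->]] := f_decomp x => eq1 eq2; exists u.
have [] := koszul2_identity (eUfU k) (fUhU k) (nat_commutes 2) eq1 eq2.
rewrite -opprB mulrN -pbw_eh_MXsub2 -[- pbw_eh _]raddfN.
move=> /f_indep[/eqP + w0] yE.
rewrite oppr_eq0 mulf_eq0 polyXsubC_eq0 orbF => /eqP q0.
move: w0 yE; rewrite q0 pbw_eh0 !mul0r !add0r => /eqP.
rewrite oppr_eq0 => /eqP w0; rewrite w0 sub0r => ->.
have [|_ /eqP] := @f_indep 0 (u * eU - z); first by rewrite pbw_eh0 add0r.
by rewrite subr_eq0 => /eqP.
Qed.

Lemma fU_lreg (u : U) : u * fU = 0 -> u = 0.
Proof. by move=> uf; have [|//] := @f_indep 0 u; rewrite pbw_eh0 add0r. Qed.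

(** Splits off the constant term of the normal form. *)
Lemma augmentation_decomp (u : U) : exists c a b w,
  u = c%:A + (a * eU + b * hU + w * fU).
Proof.
have [q [w ->]] := f_decomp u; elim/poly_ind: q => [|q p _].
  by exists 0, 0, 0, w; rewrite pbw_eh0 scale0r !mul0r !add0r.
rewrite pbw_eh_MXaddC; elim/poly_ind: p => [|p c _].
  by exists 0, 0, (pbw_eh q), w; rewrite pbw_e0 scale0r mul0r addr0 !add0r.
exists c, (pbw_e p), (pbw_eh q), w.
by rewrite pbw_e_MXaddC [LHS](AC (1*2*1) (3*((2*1)*4))).
Qed.

End Decomposition.

Section Resolution.
Variable k : fieldType.
Notation U := (envelope (sl2 k)).
Notation eU := (@eU k).
Notation hU := (@hU k).
Notation fU := (@fU k).
Notation triv := (env_module (trivial_module (sl2 k))).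

Definition row3 (R : nzRingType) (a b c : R) : 'rV[R]_3 :=
  \row_i nth 0 [:: a; b; c] i.

Lemma row3_eqP (R : nzRingType) (v : 'rV[R]_3) a b c :
  v 0 0 = a -> v 0 1 = b -> v 0 2 = c -> v = row3 a b c.
Proof.
move=> va vb vc; apply/rowP=> i; rewrite mxE.
case: i => [[|[|[|[]]]]] //= ilt.
- by rewrite -va; congr (v _ _); apply: val_inj.
- by rewrite -vb; congr (v _ _); apply: val_inj.
- by rewrite -vc; congr (v _ _); apply: val_inj.
Qed.

Lemma row3E (R : nzRingType) (a b c : R) :
  [/\ row3 a b c 0 0 = a, row3 a b c 0 1 = b & row3 a b c 0 2 = c].
Proof. by rewrite !mxE. Qed.

Lemma row3_surj (R : nzRingType) (v : 'rV[R]_3) :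
  v = row3 (v 0 0) (v 0 1) (v 0 2).
Proof. exact: row3_eqP. Qed.

Lemma row3_inj (R : nzRingType) (a b c a' b' c' : R) :
  row3 a b c = row3 a' b' c' -> [/\ a = a', b = b' & c = c'].
Proof.
move=> /rowP E; split.
- by have := E 0; rewrite !mxE.
- by have := E 1; rewrite !mxE.
- by have := E 2; rewrite !mxE.
Qed.

Definition ce_rank n :=
  match n with 0 => 1 | 1 => 3 | 2 => 3 | 3 => 1 | _ => 0 end%N.

(** Bases: e, h, f in degree 1; e /\ h, e /\ f, h /\ f in degree 2;
    e /\ h /\ f in degree 3. A row of the matrix of d is the value of d on a
    basis vector. For instance d (e /\ h) = e (x) h - h (x) e - 1 (x) [e, h],
    and [e, h] = - 2 e. *)
Definition ce_diff1 : 'M[U]_(3, 1) := \col_i nth 0 [:: eU; hU; fU] i.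
Definition ce_diff2 : 'M[U]_(3, 3) := \matrix_(i, j)
  nth 0 (nth [::] [:: [:: 2%:R - hU; eU; 0]; [:: - fU; - 1; eU];
                      [:: 0; - fU; hU + 2%:R]] i) j.
Definition ce_diff3 : 'M[U]_(1, 3) := row3 fU (- hU) eU.

Definition ce_diff n : 'M[U]_(ce_rank n.+1, ce_rank n) :=
  match n with
  | 0 => ce_diff1 | 1 => ce_diff2 | 2 => ce_diff3 | _ => 0
  end.

Lemma ord3_lift1 : lift ord0 ord0 = 1 :> 'I_3.
Proof. exact: val_inj. Qed.

Lemma ord3_lift2 : lift ord0 (lift ord0 ord0) = 2 :> 'I_3.
Proof. exact: val_inj. Qed.

Lemma row3_mul n (a b c : U) (A : 'M[U]_(3, n)) j :
  (row3 a b c *m A) 0 j = a * A 0 j + b * A 1 j + c * A 2 j.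
Proof.
rewrite mxE !big_ord_recl big_ord0 addr0 ord3_lift1 ord3_lift2.
by have [-> -> ->] := row3E a b c; rewrite addrA.
Qed.

Lemma ce_diff1E a b c :
  row3 a b c *m ce_diff1 = (a * eU + b * hU + c * fU)%:M.
Proof.
by apply/rowP=> j; rewrite row3_mul !mxE /= ord1 eqxx mulr1n.
Qed.

Lemma ce_diff2E a b c : row3 a b c *m ce_diff2 =
  row3 (a * (2%:R - hU) - b * fU) (a * eU - b - c * fU)
       (b * eU + c * (hU + 2%:R)).
Proof.
apply: row3_eqP; rewrite row3_mul !mxE /=.
- by rewrite mulr0 addr0 mulrN.
- by rewrite !mulrN mulr1.
- by rewrite mulr0 add0r.
Qed.

Lemma ce_diff3E (v : 'rV[U]_1) : v *m ce_diff3 =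
  row3 (v 0 0 * fU) (- (v 0 0 * hU)) (v 0 0 * eU).
Proof.
rewrite (mx11_scalar v) mul_scalar_mx mxE mulr1n.
by apply: row3_eqP; rewrite !mxE //= mulrN.
Qed.

Definition ce_aug (v : 'rV[U]_1) : triv := v 0 0 *: (1 : triv).

Lemma ce_aug_linear : linear ce_aug.
Proof. by move=> a u v; rewrite /ce_aug !mxE scalerDl scalerA. Qed.

Lemma triv_scale c a b w (x : triv) :
  (c%:A + (a * eU + b * hU + w * fU)) *: x = c * x :> k.
Proof.
have z0 y : env_in y *: x = 0 :> triv by rewrite env_module_inE.
rewrite [LHS]scalerDl [X in _ + X]scalerDl [X in _ + (X + _)]scalerDl.
rewrite -(scalerA a) -(scalerA b) -(scalerA w) !z0 !scaler0 !addr0.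
exact: (@env_module_algE k (sl2 k) (trivial_module (sl2 k)) c x).
Qed.

Lemma ce_aug_surj (x : triv) : exists v, ce_aug v = x.
Proof.
exists ((x : k)%:A)%:M; rewrite /ce_aug mxE mulr1n.
by have := triv_scale x 0 0 0 1; rewrite !mul0r !addr0 mulr1.
Qed.

Lemma ce_exact0 v :
  ce_aug v = 0 <-> exists w, mulmxr ce_diff1 w = v.
Proof.
rewrite /ce_aug; split=> [|[w <-]]; last first.
  rewrite /= (row3_surj w) ce_diff1E mxE mulr1n.
  have := triv_scale 0 (w 0 0) (w 0 1) (w 0 2) 1.
  by rewrite scale0r add0r mul0r.
have [c [a [b [w vE]]]] := augmentation_decomp (v 0 0).
rewrite vE [LHS]triv_scale mulr1 => c0; exists (row3 a b w).
by rewrite /= ce_diff1E [RHS]mx11_scalar vE c0 scale0r add0r.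
Qed.

Lemma ce_diff21 (w : 'rV[U]_3) : w *m ce_diff2 *m ce_diff1 = 0.
Proof.
rewrite (row3_surj w) ce_diff2E ce_diff1E.
by rewrite (koszul_d1d2 (hUeU k) (eUfU k) (fUhU k)) raddf0.
Qed.

Lemma ce_diff32 (w : 'rV[U]_1) : w *m ce_diff3 *m ce_diff2 = 0.
Proof.
rewrite ce_diff3E ce_diff2E.
have [-> -> ->] :=
  koszul_d2d3 (hUeU k) (eUfU k) (fUhU k) (nat_commutes 2) (w 0 0).
by symmetry; apply: row3_eqP; rewrite mxE.
Qed.

Lemma ce_exactS i (v : 'rV[U]_(ce_rank i.+1)) :
  mulmxr (ce_diff i) v = 0 <-> exists w, mulmxr (ce_diff i.+1) w = v.
Proof.
case: i v => [|[|[|i]]] /= v.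
- split=> [|[w <-]]; last exact: ce_diff21.
  rewrite {1}(row3_surj v) ce_diff1E => /matrixP/(_ 0 0); rewrite !mxE mulr1n.
  move=> /koszul_exact1[w1 [w2 [w3 [v0 v1 v2]]]].
  by exists (row3 w1 w2 w3); rewrite ce_diff2E; apply/esym/row3_eqP.
- split=> [|[w <-]]; last exact: ce_diff32.
  rewrite {1}(row3_surj v) ce_diff2E [RHS]row3_surj !mxE => /row3_inj[E1 E2 _].
  have [u [v0 v1 v2]] := koszul_exact2 E1 E2.
  by exists u%:M; rewrite ce_diff3E !mxE mulr1n; apply/esym/row3_eqP.
- split=> [|[w <-]]; last by rewrite mulmx0 mul0mx.
  rewrite ce_diff3E [RHS]row3_surj !mxE => /row3_inj[/fU_lreg v0 _ _].
  by exists 0; rewrite mul0mx [RHS]mx11_scalar v0 raddf0.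
- split=> _; last by rewrite mulmx0.
  by exists 0; rewrite mulmx0; apply/rowP; case.
Qed.

Definition ce_aug_map : {linear 'rV[U]_1 -> triv} := linear_map ce_aug_linear.

Definition ce_resolution : proj_resolution triv :=
  @ProjResolution k U triv (fun n => 'rV[U]_(ce_rank n))
    (fun n => mulmxr (ce_diff n)) ce_aug_map
    (fun n => @row_projective k U (ce_rank n))
    ce_aug_surj ce_exact0 ce_exactS.

(** A cochain of degree 3 is given by its value on e /\ h /\ f and is always a
    cocycle. It is a coboundary when its value lies in e V + h V + f V. *)
Theorem Ext3_coinvariants (V : lieModType (sl2 k)) d (z : 'I_d -> V) :
    (forall v : V, exists! c : 'rV[k]_d, exists v1 v2 v3,
       v = \sum_j c 0 j *: z j
         + (lact (sl2E k) v1 + lact (sl2H k) v2 + lact (sl2F k) v3)) ->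
  Ext_dim (A := U) 3 triv (env_module V) d.
Proof.
move=> zP; split; first exact/inhabits/ce_resolution.
move=> P; apply: (@cohomology_dim_indep _ _ _ _ P ce_resolution).
have ev_linear (v : env_module V) :
    linear (fun x : 'rV[U]_1 => x 0 0 *: v).
  by move=> a x y; rewrite !mxE scalerDl scalerA.
pose ev v : {linear 'rV[U]_1 -> env_module V} := linear_map (ev_linear v).
have evP (f : {linear 'rV[U]_1 -> env_module V}) x : f x = x 0 0 *: f 1.
  by rewrite -linearZ /= {1}[x]mx11_scalar scalemx1.
have sumE (c : 'rV[k]_d) (x : U) :
    \sum_j (c 0 j)%:A *: (x *: (z j : env_module V)) =
    x *: ((\sum_j c 0 j *: z j : V) : env_module V).
  rewrite scaler_sumr; apply: eq_bigr => j _.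
  by rewrite -env_module_algE !scalerA alg_commutes.
exists (fun j => ev (z j)); split=> [j x /=|f _].
  by rewrite mulmx0 mxE scale0r.
have [c [[v1 [v2 [v3 vE]]] c_uniq]] := zP (f 1 : V).
(* d (e /\ h /\ f) = (f, - h, e) explains the signs and the order *)
pose g0 (w : 'rV[U]_3) : env_module V :=
  w 0 0 *: (v3 : env_module V) - w 0 1 *: (v2 : env_module V)
  + w 0 2 *: (v1 : env_module V).
have g0_linear : linear g0.
  move=> a x y; rewrite /g0 !mxE !scalerDl !scalerDr scalerN !scalerA.
  by rewrite opprD [LHS](AC ((2*2)*2) ((1*3*5)*(2*4*6))).
exists c; split.
  exists (linear_map g0_linear \o mulmxr ce_diff3 : {linear _ -> _}).
    by exists (linear_map g0_linear).
  move=> x; rewrite evP sumE [X in _ + X]/= ce_diff3E /g0.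
  have [-> -> ->] := row3E (x 0 0 * fU) (- (x 0 0 * hU)) (x 0 0 * eU).
  rewrite scaleNr opprK [in LHS]vE -!scalerA !env_module_inE -!scalerDr.
  by congr (_ *: (_ + _ : env_module V)); rewrite [RHS](ACl (3*2*1)).
move=> c' [b [g gE] fE]; apply: c_uniq.
have rowE (x y w : U) : row3 x y w =
    x *: row3 1 0 0 + y *: row3 0 1 0 + w *: row3 0 0 1.
  by symmetry; apply: row3_eqP; rewrite !mxE /= !(mulr0, mulr1, addr0, add0r).
exists (g (row3 0 0 1)), (- g (row3 0 1 0)), (g (row3 1 0 0)).
rewrite [LHS]fE sumE gE /= ce_diff3E mxE eqxx !mul1r scale1r.
rewrite rowE !linearD !linearZ /= -!env_module_inE scaleNr scalerN.
by congr (_ + _ : env_module V); rewrite [LHS](ACl (3*2*1)).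
Qed.

End Resolution.

(** * Coinvariants of the symmetric powers through monomials *)

Section Coinvariants.
Variable k : fieldType.
Notation S := {mpoly k[3]}.
Notation E := (sl2E k).
Notation H := (sl2H k).
Notation F := (sl2F k).

Definition sl2_mon a b c : S := 'X_0 ^+ a * 'X_1 ^+ b * 'X_2 ^+ c.

Lemma mpolyX_mon (m : 'X_{1..3}) : 'X_[m] = sl2_mon (m 0) (m 1) (m 2).
Proof.
rewrite [LHS]mpolyXE_id !big_ord_recl big_ord0 mulr1 mulrA.
by rewrite ord3_lift1 ord3_lift2.
Qed.

Definition mnm3 (a b c : nat) : 'X_{1..3} :=
  [multinom nth 0%N [:: a; b; c] i | i < 3].

Lemma mon_mpolyX a b c : sl2_mon a b c = 'X_[mnm3 a b c].
Proof. by rewrite mpolyX_mon !mnmE. Qed.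

Lemma mdeg_mnm3 a b c : mdeg (mnm3 a b c) = (a + b + c)%N.
Proof. by rewrite mdegE !big_ord_recl big_ord0 !mnmE /= addn0 addnA. Qed.

Lemma mdeg3 (m : 'X_{1..3}) : mdeg m = (m 0%R + m 1%R + m 2%R)%N.
Proof.
by rewrite mdegE !big_ord_recl big_ord0 ord3_lift1 ord3_lift2 addn0 addnA.
Qed.

Lemma mon_homog a b c n : (a + b + c)%N = n -> sl2_mon a b c \is n.-homog.
Proof. by move=> <-; rewrite mon_mpolyX dhomogX; apply/eqP/mdeg_mnm3. Qed.

Lemma lie_EE : lie E E = 0. Proof. exact: liexx. Qed.
Lemma lie_EH : lie E H = - (E *+ 2). Proof. by rewrite lieC lie_HE. Qed.
Lemma lie_HH : lie H H = 0. Proof. exact: liexx. Qed.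
Lemma lie_FE : lie F E = - H. Proof. by rewrite lieC lie_EF. Qed.
Lemma lie_FH : lie F H = F *+ 2. Proof. by rewrite lieC lie_HF opprK. Qed.
Lemma lie_FF : lie F F = 0. Proof. exact: liexx. Qed.

Lemma formE : sl2_form E = 'X_0.
Proof.
rewrite /sl2_form !big_ord_recl big_ord0 ord3_lift1 ord3_lift2 /sl2_coord.
rewrite !(tnth_nth 0) /= !mxE /=.
by rewrite scale1r !scale0r !addr0.
Qed.
Lemma formH : sl2_form H = 'X_1.
Proof.
rewrite /sl2_form !big_ord_recl big_ord0 ord3_lift1 ord3_lift2 /sl2_coord.
rewrite !(tnth_nth 0) /= !mxE /=.
by rewrite !subr0 scale1r !scale0r add0r !addr0.
Qed.
Lemma formF : sl2_form F = 'X_2.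
Proof.
rewrite /sl2_form !big_ord_recl big_ord0 ord3_lift1 ord3_lift2 /sl2_coord.
rewrite !(tnth_nth 0) /= !mxE /=.
by rewrite scale1r !scale0r !add0r addr0.
Qed.

Lemma der_exp x (p : S) m :
  sl2_der x (p ^+ m) = m%:R * p ^+ m.-1 * sl2_der x p.
Proof.
elim: m => [|m IHm].
  rewrite expr0 mulr0n !mul0r /sl2_der big1 // => i _.
  by rewrite mderivC mulr0.
rewrite exprS sl2_derM IHm.
by case: m {IHm} => [|m] /=; rewrite ?expr0 ?exprS; ring.
Qed.

Lemma der_mon x a b c : sl2_der x (sl2_mon a b c) =
  (a%:R * 'X_0 ^+ a.-1 * sl2_der x 'X_0) * 'X_1 ^+ b * 'X_2 ^+ c
  + 'X_0 ^+ a * (b%:R * 'X_1 ^+ b.-1 * sl2_der x 'X_1) * 'X_2 ^+ c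
  + 'X_0 ^+ a * 'X_1 ^+ b * (c%:R * 'X_2 ^+ c.-1 * sl2_der x 'X_2).
Proof. by rewrite /sl2_mon !sl2_derM !der_exp; ring. Qed.

Lemma derE_mon a b c : sl2_der E (sl2_mon a b c) =
  - (b%:R *+ 2) *: sl2_mon a.+1 b.-1 c + c%:R *: sl2_mon a b.+1 c.-1.
Proof.
rewrite der_mon -formE -formH -formF !sl2_der_form lie_EE lie_EH lie_EF.
rewrite raddf0 raddfN raddfMn /= formE formH formF /sl2_mon.
by rewrite -!mul_mpolyC !(mpolyCN, mpolyCMn, mpolyC_nat) !exprS; ring.
Qed.

Lemma derF_mon a b c : sl2_der F (sl2_mon a b c) =
  - a%:R *: sl2_mon a.-1 b.+1 c + (b%:R *+ 2) *: sl2_mon a b.-1 c.+1.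
Proof.
rewrite der_mon -formE -formH -formF !sl2_der_form lie_FE lie_FH lie_FF.
rewrite raddf0 raddfN raddfMn /= formE formH formF /sl2_mon.
by rewrite -!mul_mpolyC !(mpolyCN, mpolyCMn, mpolyC_nat) !exprS; ring.
Qed.

Lemma derH_mon a b c : sl2_der H (sl2_mon a b c) =
  ((a%:R - c%:R) *+ 2) *: sl2_mon a b c.
Proof.
rewrite der_mon -formE -formH -formF !sl2_der_form lie_HE lie_HH lie_HF.
rewrite raddf0 raddfN !raddfMn /= formE formH formF /sl2_mon.
rewrite -!mul_mpolyC !(mpolyCN, mpolyCB, mpolyCMn, mpolyC_nat).
case: a => [|a]; case: c => [|c] /=; rewrite ?exprS; ring.
Qed.

Section Degree.
Variable n : nat.

Definition in_gS (v : S) : Prop := exists p q r : S,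
  [/\ p \is n.-homog, q \is n.-homog, r \is n.-homog
    & v = sl2_der E p + sl2_der H q + sl2_der F r].

Lemma in_gS0 : in_gS 0.
Proof. by exists 0, 0, 0; rewrite !rpred0 !linear0 !addr0. Qed.

Lemma in_gS_linear a v w : in_gS v -> in_gS w -> in_gS (a *: v + w).
Proof.
move=> [p [q [r [hp hq hr ->]]]] [p' [q' [r' [hp' hq' hr' ->]]]].
exists (a *: p + p'), (a *: q + q'), (a *: r + r').
rewrite !rpredD ?rpredZ //; split=> //.
by rewrite !linearP /= !scalerDr [LHS](AC (3*3) ((1*4)*(2*5)*(3*6))).
Qed.

Lemma in_gSZ a v : in_gS v -> in_gS (a *: v).
Proof. by move=> hv; rewrite -[_ *: v]addr0; apply/in_gS_linear/in_gS0. Qed.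

Lemma in_gS_derE a b c : (a + b + c)%N = n -> in_gS (sl2_der E (sl2_mon a b c)).
Proof.
move=> abc; exists (sl2_mon a b c), 0, 0.
by rewrite !rpred0 !linear0 !addr0 mon_homog.
Qed.
Lemma in_gS_derH a b c : (a + b + c)%N = n -> in_gS (sl2_der H (sl2_mon a b c)).
Proof.
move=> abc; exists 0, (sl2_mon a b c), 0.
by rewrite !rpred0 !linear0 addr0 add0r mon_homog.
Qed.
Lemma in_gS_derF a b c : (a + b + c)%N = n -> in_gS (sl2_der F (sl2_mon a b c)).
Proof.
move=> abc; exists 0, 0, (sl2_mon a b c).
by rewrite !rpred0 !linear0 !add0r mon_homog.
Qed.

(** The linear form on S^n whose value on e^a h^b f^c is lam a c. *)
Definition monomial_sum (lam : nat -> nat -> k) (v : S) : k :=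
  \sum_(m : 'X_{1..3 < n.+1}) v@_m * lam (m 0%R) (m 2%R).

Lemma monomial_sum_linear lam : linear (monomial_sum lam : S -> k^o).
Proof.
move=> a v w; rewrite /monomial_sum scaler_sumr -big_split.
apply: eq_bigr => m _.
by rewrite mcoeffD mcoeffZ mulrDl [in RHS]/GRing.scale /= mulrA.
Qed.

HB.instance Definition _ lam := GRing.isLinear.Build k S k^o *:%R
  (monomial_sum lam) (monomial_sum_linear lam).

Lemma monomial_sum_mon lam a b c : (a + b + c <= n)%N ->
  monomial_sum lam (sl2_mon a b c) = lam a c.
Proof.
move=> abc; have mlt : (mdeg (mnm3 a b c) < n.+1)%N by rewrite mdeg_mnm3.
rewrite /monomial_sum (bigD1 (BMultinom mlt)) //= big1 => [|m /eqP mE].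
  by rewrite addr0 mon_mpolyX mcoeffX eqxx mul1r !mnmE.
rewrite mon_mpolyX mcoeffX; case: eqP => [Em|]; last by rewrite mul0r.
by case: mE; apply: val_inj.
Qed.

(** The conditions under which the linear form given by lam vanishes on the
    images of e, h and f. The formulas for the three derivations on monomials
    contain b - 1, a - 1 and c - 1, which are truncated at 0; their coefficient
    is then 0. *)
Record sl2_invariant (lam : nat -> nat -> k) : Prop := Sl2Invariant {
  inv_E : forall a b c, (a + b + c)%N = n ->
    c%:R * lam a c.-1 = (b%:R *+ 2) * lam a.+1 c;
  inv_H : forall a c, (a + c <= n)%N -> (a%:R - c%:R) * lam a c = 0;
  inv_F : forall a b c, (a + b + c)%N = n ->
    a%:R * lam a.-1 c = (b%:R *+ 2) * lam a c.+1
}.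

Lemma homog_mon_sum (v : S) :
  v = \sum_(m <- msupp v) v@_m *: sl2_mon (m 0%R) (m 1%R) (m 2%R).
Proof. by rewrite {1}[v]mpolyE; apply: eq_bigr => m _; rewrite mpolyX_mon. Qed.

Lemma homog_deg (v : S) m : v \is n.-homog -> m \in msupp v ->
  (m 0%R + m 1%R + m 2%R)%N = n.
Proof. by move=> /dhomogP hv /hv <-; rewrite -mdeg3. Qed.

Lemma homog_ind (P : S -> Prop) :
    P 0 -> (forall a v w, P v -> P w -> P (a *: v + w)) ->
    (forall a b c, (a + b + c)%N = n -> P (sl2_mon a b c)) ->
  forall v, v \is n.-homog -> P v.
Proof.
move=> P0 PD Pmon v hv; rewrite [v]homog_mon_sum big_seq.
elim/big_ind: _ => // [v1 v2 Pv1 Pv2|m mv].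
  by rewrite -[v1]scale1r; apply: PD.
by rewrite -[_ *: _]addr0; apply/PD/P0/Pmon/(homog_deg hv).
Qed.

Lemma monomial_sumZ lam x a b c : x = 0 \/ (a + b + c <= n)%N ->
  monomial_sum lam (x *: sl2_mon a b c) = x * lam a c.
Proof.
case=> [->|abc]; first by rewrite scale0r linear0 mul0r.
by rewrite linearZ /= monomial_sum_mon.
Qed.

Lemma sl2_invariant_in_gS lam v :
  sl2_invariant lam -> in_gS v -> monomial_sum lam v = 0.
Proof.
move=> inv [p [q [r [hp hq hr ->]]]].
have L x : (forall a b c, (a + b + c)%N = n ->
    monomial_sum lam (sl2_der x (sl2_mon a b c)) = 0) ->
  forall v, v \is n.-homog -> monomial_sum lam (sl2_der x v) = 0.
  move=> xmon; apply: homog_ind => //; first by rewrite !linear0.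
  by move=> a v1 v2 v1E v2E; rewrite !linearP /= v1E v2E scaler0 addr0.
rewrite !linearD /= !L ?addr0 // => a b c abc.
- rewrite derF_mon linearD /= !monomial_sumZ.
  + by rewrite mulNr (inv_F inv abc) addNr.
  + by case: a abc => [|a] abc; [left; rewrite oppr0 | right; lia].
  + by case: b abc => [|b] abc; [left; rewrite mul0rn | right; lia].
- rewrite derH_mon monomial_sumZ; last by right; rewrite abc.
  by rewrite mulrnAl (inv_H inv) ?mul0rn // -abc; lia.
- rewrite derE_mon linearD /= !monomial_sumZ.
  + by rewrite mulNr (inv_E inv abc) addNr.
  + by case: b abc => [|b] abc; [left; rewrite mul0rn oppr0 | right; lia].
  + by case: c abc => [|c] abc; [left | right; lia].
Qed.

Definition degree_mon a c := sl2_mon a (n - a - c) c.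

Lemma degree_mon_deg a c : (a + c <= n)%N -> (a + (n - a - c) + c)%N = n.
Proof. by lia. Qed.

(** Monomials that span the coinvariants and have a dual family of invariant
    linear forms are a basis of the coinvariants. The family of forms also gives
    the coordinates, which is why it appears in the spanning condition. *)
Lemma coinvariants_criterion (I : finType) (rep : I -> nat * nat)
    (lam : I -> nat -> nat -> k) :
    (forall i, (rep i).1 + (rep i).2 <= n)%N ->
    (forall i, sl2_invariant (lam i)) ->
    (forall i j, lam i (rep j).1 (rep j).2 = (i == j)%:R) ->
    (forall a b c, (a + b + c)%N = n ->
       in_gS (sl2_mon a b c
              - \sum_i lam i a c *: degree_mon (rep i).1 (rep i).2)) ->
  Ext_dim (A := envelope (sl2 k)) 3 (env_module (trivial_module (sl2 k)))
    (env_module (sl2_sym k n)) #|I|.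
Proof.
move=> rep_deg lam_inv lam_rep span.
have zH i : degree_mon (rep i).1 (rep i).2 \is n.-homog.
  by apply/mon_homog/degree_mon_deg.
pose z (i : I) : sl2_sym k n := DHomog (zH i).
apply: (@Ext3_coinvariants k (sl2_sym k n) #|I| (fun j => z (enum_val j))) => v.
have valE (w v1 v2 v3 : sl2_sym k n) c :
    w = \sum_(j < #|I|) c j *: z (enum_val j)
      + (lact E v1 + lact H v2 + lact F v3) ->
    val w = \sum_(j < #|I|)
        c j *: degree_mon (rep (enum_val j)).1 (rep (enum_val j)).2
      + (sl2_der E (val v1) + sl2_der H (val v2) + sl2_der F (val v3)) :> S.
  move=> ->; rewrite !(raddfD (val : sl2_sym k n -> S)) /=; congr (_ + _).
  by rewrite raddf_sum; exact: eq_bigr.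
have v_homog : val v \is n.-homog by apply: dhomog_is_dhomog.
exists (\row_j monomial_sum (lam (enum_val j)) (val v)); split; last first.
  move=> c [v1 [v2 [v3 vE]]]; apply/rowP => j; rewrite mxE.
  rewrite (valE _ _ _ _ (c 0) vE) linearD /= [X in _ + X]sl2_invariant_in_gS //.
  2: by exists (val v1), (val v2), (val v3); split; rewrite ?dhomog_is_dhomog.
  rewrite addr0 linear_sum (bigD1 j) //= big1 => [|i ij].
    rewrite linearZ /= monomial_sum_mon; last first.
      by rewrite degree_mon_deg.
    by rewrite addr0 lam_rep eqxx -[RHS]mulr1.
  rewrite linearZ /= monomial_sum_mon; last first.
    by rewrite degree_mon_deg.
  by rewrite lam_rep (inj_eq enum_val_inj) eq_sym (negPf ij) [LHS]mulr0.
have [p [q [r [hp hq hr vE]]]] : in_gS (val v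
    - \sum_i monomial_sum (lam i) (val v) *: degree_mon (rep i).1 (rep i).2).
  move: (val v) v_homog; apply: homog_ind.
  - rewrite big1 ?subr0 => [|i _]; first exact: in_gS0.
    by rewrite linear0 scale0r.
  - move=> a v1 v2 h1 h2; have := in_gS_linear a h1 h2.
    congr in_gS; rewrite scalerBr addrACA -opprD; congr (_ - _).
    rewrite scaler_sumr -big_split; apply: eq_bigr => i _ /=.
    by rewrite linearP scalerA scalerDl.
  - move=> a b c abc; have := span a b c abc; congr (in_gS (_ - _)).
    by apply: eq_bigr => i _; rewrite monomial_sum_mon // abc.
exists (DHomog hp), (DHomog hq), (DHomog hr); apply: val_inj.
rewrite (valE _ _ _ _ _ erefl) /= -vE.
rewrite (reindex_onto (@enum_val I predT) enum_rank) /=; last first.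
  by move=> i _; rewrite enum_rankK.
rewrite [X in _ + (_ - X)](eq_bigl predT) => [|j]; last first.
  by rewrite enum_valK eqxx.
under eq_bigr do rewrite mxE.
by rewrite addrC subrK.
Qed.

End Degree.

End Coinvariants.

(** * The generic case *)

Lemma card_triangle Q :
  #|{: {x : 'I_Q * 'I_Q | (x.1 + x.2 < Q)%N}}| = 'C(Q.+1, 2).
Proof.
rewrite card_sig -sum1_card.
rewrite -(pair_big_dep predT (fun i j : 'I_Q => i + j < Q) (fun _ _ => 1))%N.
rewrite /=.
have -> : (\sum_(i < Q) \sum_(j < Q | i + j < Q) 1 = \sum_(i < Q) (Q - i))%N.
  apply: eq_bigr => i _; rewrite -[RHS]muln1 -[X in (X * _)%N]card_ord.
  rewrite -sum_nat_const.
  rewrite (big_ord_widen Q (fun=> 1%N)) ?leq_subr //.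
  by apply: eq_bigl => j; lia.
rewrite (reindex_inj rev_ord_inj) /= -bin2_sum big_mkord big_ord_recl add0n.
by apply: eq_bigr => i _; rewrite /= /bump; have := ltn_ord i; lia.
Qed.

Section PositiveCharacteristic.
Variables (k : fieldType) (p : nat).
Hypothesis p_char : p \in [pchar k].
Hypothesis p_gt2 : (2 < p)%N.
Notation S := {mpoly k[3]}.

Lemma natr_char : p%:R = 0 :> k. Proof. exact: pcharf0. Qed.

Lemma natr_neq0 d : (0 < d < p)%N -> d%:R != 0 :> k.
Proof.
by move=> /andP[d0 dp]; rewrite -(dvdn_pcharf p_char) gtnNdvd.
Qed.

Lemma natr_MDl i a : (i * p + a)%:R = a%:R :> k.
Proof. by rewrite natrD natrM natr_char mulr0 add0r. Qed.

Lemma natr_eqP a c : a%:R = c%:R :> k -> a = c %[mod p].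
Proof.
wlog ac : a c / (a <= c)%N => [H acE|].
  by case/orP: (leq_total a c) => ac; [|symmetry]; apply: H.
move=> acE; apply/esym/eqP; rewrite eqn_mod_dvd // (dvdn_pcharf p_char).
by rewrite natrB // acE subrr.
Qed.

Lemma two_neq0 : 2%:R != 0 :> k. Proof. by apply: natr_neq0. Qed.

(** The pair (t, Q) encodes n + 1 modulo p in a form that puts the middle
    exponent of e^(i p + t) h^b f^(m p + t) at b = (Q - i - m) p - 1. *)
Section Generic.
Variables (n Q t : nat).
Hypothesis n_def : n.+1 = (Q * p + t.*2)%N.
Hypothesis t_ltp : (t < p)%N.

(** A solution of the recurrence 4 (u + 1) x(u + 1) = - (t + u + 1) x(u) with
    x(0) = 1. It relates the monomials s = t + u of a high part to its first
    one. *)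
Definition block_coef u : k := (- 4%:R^-1) ^+ u * 'C(t + u, u)%:R.

Lemma block_coef0 : block_coef 0 = 1.
Proof. by rewrite /block_coef addn0 bin0 mulr1. Qed.

Lemma block_coefS u :
  4%:R * u.+1%:R * block_coef u.+1 = - ((t + u).+1%:R * block_coef u).
Proof.
have four : 4%:R != 0 :> k by rewrite (natrM _ 2 2) mulf_neq0 ?two_neq0.
have binE : u.+1%:R * 'C(t + u.+1, u.+1)%:R =
    (t + u).+1%:R * 'C(t + u, u)%:R :> k.
  by rewrite -!natrM -mul_bin_diag addnS.
rewrite /block_coef exprS -mulrA [u.+1%:R * _]mulrCA binE; field.
exact: four.
Qed.

(** The invariant form that detects the high part of the block (i, m). *)
Definition block_form (i m a c : nat) : k :=
  if [&& a %/ p == i, c %/ p == m, a %% p == c %% p & t <= a %% p]%N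
  then block_coef (a %% p - t)%N else 0.

Lemma block_formC i m a c : block_form i m a c = block_form m i c a.
Proof.
rewrite /block_form [(c %% p == _)%N]eq_sym; case: eqP => _; case: eqP => _ //=.
by case: eqP => //= ->.
Qed.

Lemma block_formE i m i0 m0 s s' : (s < p)%N -> (s' < p)%N ->
  block_form i m (i0 * p + s) (m0 * p + s') =
  if [&& i0 == i, m0 == m, s == s' & (t <= s)%N]
  then block_coef (s - t)%N else 0.
Proof.
move=> alp gap; have p_gt0 : (0 < p)%N by lia.
rewrite /block_form !divnMDl // (divn_small alp) (divn_small gap).
by rewrite !modnMDl !modn_small // !addn0.
Qed.

Lemma exponent_decomp a : exists i s, (s < p)%N /\ a = (i * p + s)%N.
Proof.
exists (a %/ p)%N, (a %% p)%N; split; first by rewrite ltn_mod; lia.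
exact: divn_eq.
Qed.

(** In k the middle exponent depends only on the residues of the outer ones. *)
Lemma middle_exponent i m s s' b : (i * p + s + b + (m * p + s'))%N = n ->
  b%:R = t%:R *+ 2 - 1 - s%:R - s'%:R :> k.
Proof.
move=> bE; have : (i * p + s + b + (m * p + s')).+1%:R = (t.*2)%:R :> k.
  by rewrite bE n_def natr_MDl.
rewrite -addn1 !natrD !natrM natr_char -addnn natrD !mulr0 => E.
rewrite -[X in X - 1](_ : t%:R + t%:R = _) // -E; ring.
Qed.

(** The condition links consecutive monomials of one block, where it is the
    recurrence of [block_coef]. Just below the high part, at s = t - 1, it
    holds because b = 0 in k; between the last monomial of a block and the first
    one of the next, because c = 0 in k and, if t = 0, also b = 0. *)
Lemma block_form_invE i m a b c : (a + b + c)%N = n ->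
  c%:R * block_form i m a c.-1 = (b%:R *+ 2) * block_form i m a.+1 c.
Proof.
have p_gt0 : (0 < p)%N by lia.
have [i0 [s [alp ->]]] := exponent_decomp a.
have [m0 [[|s'] [gap ->]]] := exponent_decomp c => abc.
  rewrite natr_MDl mul0r; have [alS|alS] := ltnP s.+1 p.
    by rewrite -addnS block_formE //= !andbF mulr0.
  have -> : (i0 * p + s).+1 = (i0.+1 * p + 0)%N by rewrite mulSn; lia.
  rewrite block_formE //; case: ifP => [/and4P[_ _ _]|_]; last by rewrite mulr0.
  rewrite leqn0 => /eqP t0.
  rewrite (middle_exponent abc) t0 mul0rn sub0r subr0.
  have -> : s = p.-1 by lia.
  have -> : p.-1%:R = -1 :> k.
    by apply/eqP; rewrite -addr_eq0 natr1 prednK // natr_char.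
  by rewrite opprK addNr mul0rn mul0r.
have predE : (m0 * p + s'.+1).-1 = (m0 * p + s')%N by rewrite addnS.
rewrite predE; have [alS|alS] := ltnP s.+1 p; last first.
  have -> : (i0 * p + s).+1 = (i0.+1 * p + 0)%N by rewrite mulSn; lia.
  rewrite !block_formE ?(ltnW gap) //.
  have -> : (s == s') = false by lia.
  by rewrite /= !andbF !mulr0.
rewrite -addnS !block_formE ?(ltnW gap) //.
rewrite eqSS; have [/and3P[/eqP <- /eqP <- /eqP alga]|] :=
    boolP [&& i0 == i, m0 == m & s == s']; last first.
  by rewrite !negb_and => /or3P[] /negPf ->; rewrite ?andbF !mulr0.
rewrite -alga !eqxx /=; rewrite -alga in abc.
rewrite natr_MDl (middle_exponent abc).
have [t_al|al_t] := leqP t s.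
  rewrite (leqW t_al) subSn //; have := block_coefS (s - t)%N.
  rewrite subnKC // -[(s - t)%N.+1%:R]natr1 natrB // => E.
  have -> : (t%:R *+ 2 - 1 - s%:R - s.+1%:R) *+ 2 =
      - (4%:R * (s%:R - t%:R + 1)) :> k by rewrite -[s.+1%:R]natr1; ring.
  by rewrite mulNr E opprK.
rewrite mulr0; have [t_alS|] := leqP t s.+1; last by rewrite mulr0.
have -> : t = s.+1 by lia.
by rewrite -natr1; ring.
Qed.

(** Exchanging e and f turns the condition for e into the one for f. *)
Lemma block_form_invariant i m : sl2_invariant n (block_form i m).
Proof.
split=> [a b c|a c _|a b c abc]; first exact: block_form_invE.
  rewrite /block_form; case: and4P => [[_ _ /eqP ac _]|]; last by rewrite mulr0.
  by rewrite (divn_eq a p) (divn_eq c p) !natr_MDl ac subrr mul0r.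
rewrite block_formC [X in _ = _ * X]block_formC; apply: block_form_invE.
by lia.
Qed.

Notation gS := (in_gS n).

Lemma in_gS_cancel x (v : S) : x != 0 -> gS (x *: v) -> gS v.
Proof.
by move=> x0 /(in_gSZ x^-1); rewrite scalerA mulVf // scale1r.
Qed.

(** The coefficient 2 (b - 1) = - 4 (u + 1) of the relation is invertible since
    u + 1 < p, which expresses every monomial of a high part through the first
    one. *)
Lemma block_reduce i m u b : (t + u < p)%N ->
    (i * p + (t + u) + b + (m * p + (t + u)))%N = n ->
  gS (sl2_mon k (i * p + (t + u)) b (m * p + (t + u))
      - block_coef u *: degree_mon k n (i * p + t) (m * p + t)).
Proof.
elim: u b => [|u IHu] b tu abc.
  rewrite /degree_mon block_coef0 scale1r addn0.
  have -> : (n - (i * p + t) - (m * p + t))%N = b by lia.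
  by rewrite subrr; apply: in_gS0.
have IH : gS (sl2_mon k (i * p + (t + u)) b.+2 (m * p + (t + u))
      - block_coef u *: degree_mon k n (i * p + t) (m * p + t)).
  by apply: IHu; lia.
have rel : gS (sl2_der (sl2E k)
    (sl2_mon k (i * p + (t + u)) b.+1 (m * p + (t + u.+1)))).
  by apply: in_gS_derE; lia.
move: rel; rewrite derE_mon /= !addnS /=.
set M := sl2_mon _ _ b.+2 _ in IH *; set M' := sl2_mon _ _ b _.
set R := degree_mon _ _ _ _ in IH *.
rewrite -addnS natr_MDl => rel.
have bE : b.+1%:R *+ 2 = - (4%:R * u.+1%:R) :> k.
  by rewrite -natr1 (middle_exponent abc) !natrD; ring.
have x0 : b.+1%:R *+ 2 != 0 :> k.
  rewrite bE oppr_eq0 mulf_neq0 ?(natrM _ 2 2) ?mulf_neq0 ?two_neq0 //.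
  by apply: natr_neq0; lia.
apply: (in_gS_cancel x0).
have := in_gS_linear (-1) rel (in_gSZ (t + u).+1%:R IH).
have xE : b.+1%:R *+ 2 * block_coef u.+1 = (t + u).+1%:R * block_coef u.
  by rewrite bE mulNr block_coefS opprK.
congr in_gS; rewrite !scalerBr !scalerA xE scaleN1r opprD scaleNr opprK.
by rewrite addrA subrK.
Qed.

(** Going up from s to s + 1 is possible because the coefficient s + 1 is
    invertible. The process stops at s = t - 1, where the other side of the
    relation vanishes; the bound on i + m keeps the middle exponent positive up
    to there. *)
Lemma block_low i m s b : (s < t)%N -> (i + m <= Q)%N ->
  (i * p + s + b + (m * p + s))%N = n ->
  gS (sl2_mon k (i * p + s) b (m * p + s)).
Proof.
move=> al_t im; have imQ : (i * p + m * p <= Q * p)%N.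
  by rewrite -mulnDl leq_mul2r im orbT.
have [d dE] : exists d, d = (t - s)%N by eexists.
elim: d s b dE al_t => [|d IHd] s b dE al_t abc; first by lia.
case: b abc => [|b] abc; first by lia.
have al1 : s.+1%:R != 0 :> k by apply: natr_neq0; lia.
apply: (in_gS_cancel al1).
have rel : gS (sl2_der (sl2E k) (sl2_mon k (i * p + s) b (m * p + s.+1))).
  by apply: in_gS_derE; lia.
move: rel; rewrite derE_mon /= natr_MDl addnS /= => rel.
have [/eqP b0|b0] := boolP (b%:R == 0 :> k).
  by move: rel; rewrite b0 mul0rn oppr0 scale0r add0r.
case: b b0 rel abc => [|b] b0 rel abc; first by rewrite eqxx in b0.
(* b + 1 is not 0 in k, so the last link of the low part is not reached *)
have al_t1 : (s.+1 < t)%N.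
  rewrite ltnNge; apply/negP => t_al; case/negP: b0.
  have tE : t = s.+1 by lia.
  have := middle_exponent abc.
  rewrite -[b.+2%:R]natr1 tE -[s.+1%:R]natr1 => bE.
  by apply/eqP; rewrite -[LHS](addrK 1) bE; ring.
have IH : gS (sl2_mon k (i * p + s.+1) b (m * p + s.+1)) by apply: IHd; lia.
have := in_gS_linear (b.+1%:R *+ 2) IH rel; congr in_gS.
by rewrite !addnS /= scaleNr addrA subrr add0r.
Qed.

(** Going down from s to s - 1, as 2 (t - s) is invertible for s < t. At s = 0
    the monomial is, up to a unit, the image under e of a monomial with exponent
    i p - 1 or the image under f of one with exponent m p - 1. *)
Lemma block_high i m s b : (s < t)%N -> (0 < i + m)%N ->
  (i * p + s + b + (m * p + s))%N = n ->
  gS (sl2_mon k (i * p + s) b (m * p + s)).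
Proof.
move=> al_t im; elim: s b al_t => [|s IHal] b al_t abc.
  have b1E : b.+1%:R *+ 2 = t%:R * (2%:R * 2%:R) :> k.
    by rewrite -natr1 (middle_exponent abc); ring.
  have b1 : b.+1%:R *+ 2 != 0 :> k.
    by rewrite b1E !mulf_neq0 ?two_neq0 //; apply: natr_neq0; lia.
  rewrite !addn0 in abc *; have p_gt0 : (0 < p)%N by lia.
  have mp0 j : (j * p)%:R = 0 :> k by rewrite natrM natr_char mulr0.
  (* the exponents of e and f are 0 in k, which leaves a single term *)
  have [i0|i_gt0] := posnP i.
    have [c cE] : exists c, (m * p)%N = c.+1.
      by exists (m * p).-1; rewrite prednK // muln_gt0 p_gt0; lia.
    have /in_gS_derF : (i * p + b.+1 + c)%N = n by lia.
    move=> /(_ k); rewrite derF_mon /= -cE mp0 oppr0 scale0r add0r.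
    exact: in_gS_cancel.
  have [a aE] : exists a, (i * p)%N = a.+1.
    by exists (i * p).-1; rewrite prednK // muln_gt0 p_gt0; lia.
  have /in_gS_derE : (a + b.+1 + m * p)%N = n by lia.
  move=> /(_ k); rewrite derE_mon /= -aE mp0 scale0r addr0.
  by apply: in_gS_cancel; rewrite oppr_eq0.
have IH : gS (sl2_mon k (i * p + s) b.+2 (m * p + s)) by apply: IHal; lia.
have rel : gS (sl2_der (sl2E k) (sl2_mon k (i * p + s) b.+1 (m * p + s.+1))).
  by apply: in_gS_derE; lia.
have bE : b.+1%:R *+ 2 = (t - s.+1)%:R * (2%:R * 2%:R) :> k.
  by rewrite -[b.+1%:R]natr1 (middle_exponent abc) natrB; [ring | lia].
have b0 : b.+1%:R *+ 2 != 0 :> k.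
  by rewrite bE !mulf_neq0 ?two_neq0 //; apply: natr_neq0; lia.
apply: (in_gS_cancel b0); rewrite !addnS.
move: rel; rewrite derE_mon /= !addnS /= => rel.
have := in_gS_linear (-1) rel (in_gSZ (m * p + s).+1%:R IH); congr in_gS.
by rewrite scaleN1r opprD scaleNr opprK subrK.
Qed.

Lemma block_bound i m s b : (t <= s)%N ->
  (i * p + s + b + (m * p + s))%N = n -> (i + m < Q)%N.
Proof.
move=> t_al abc; rewrite ltnNge; apply/negP => imQ.
have : (Q * p <= i * p + m * p)%N by rewrite -mulnDl leq_mul2r imQ orbT.
lia.
Qed.

Theorem Ext3_generic :
  Ext_dim (A := envelope (sl2 k)) 3 (env_module (trivial_module (sl2 k)))
    (env_module (sl2_sym k n)) 'C(Q.+1, 2).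
Proof.
rewrite -card_triangle.
pose I : finType := {: {x : 'I_Q * 'I_Q | (x.1 + x.2 < Q)%N}}.
pose rep (x : I) := ((val x).1 * p + t, (val x).2 * p + t)%N.
apply: (@coinvariants_criterion k n I rep
    (fun x : I => block_form (val x).1 (val x).2)).
- move=> [[i m] /= im]; rewrite /rep /=.
  have : (i * p + m * p + p <= Q * p)%N.
    by rewrite -mulnDl -mulSnr leq_mul2r im orbT.
  lia.
- by move=> x; apply: block_form_invariant.
- move=> [[i m] im] [[i' m'] im'].
  rewrite block_formE //= eqxx leqnn !andbT subnn block_coef0.
  rewrite -val_eqE /= xpair_eqE [i == i']eq_sym [m == m']eq_sym.
  by rewrite -!val_eqE; case: ifP.
move=> a b c.
have [i [s [alp ->]]] := exponent_decomp a.
have [m [s' [gap ->]]] := exponent_decomp c => abc.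
have off_block : ~~ ((s == s') && (t <= s)%N) ->
    gS (sl2_mon k (i * p + s) b (m * p + s')) ->
  gS (sl2_mon k (i * p + s) b (m * p + s') - \sum_(x : I)
    block_form (val x).1 (val x).2 (i * p + s) (m * p + s')
      *: degree_mon k n (rep x).1 (rep x).2).
  move=> ag; rewrite big1 ?subr0 // => x _; rewrite block_formE //.
  case: ifP => [/and4P[_ _ ag1 ag2]|_]; last by rewrite scale0r.
  by rewrite ag1 ag2 in ag.
have [alga|alga] := eqVneq s s'; last first.
  apply: off_block; first by rewrite (negPf alga).
  have /in_gS_derH := abc; move=> /(_ k); rewrite derH_mon; apply: in_gS_cancel.
  rewrite -mulr_natl mulf_neq0 ?two_neq0 // subr_eq0 !natr_MDl.
  by apply: contraNneq alga => /natr_eqP; rewrite !modn_small // => /eqP.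
rewrite -alga in abc off_block *.
have [al_t|t_al] := ltnP s t.
  apply: off_block; first by rewrite eqxx leqNgt al_t.
  have [imQ|imQ] := leqP (i + m) Q; first exact: block_low.
  by apply: block_high => //; lia.
have im := block_bound t_al abc.
have iQ : (i < Q)%N by lia.
have mQ : (m < Q)%N by lia.
pose x : I := exist (fun x : 'I_Q * 'I_Q => x.1 + x.2 < Q)%N
  (Ordinal iQ, Ordinal mQ) im.
rewrite (bigD1 x) //= big1 => [|[[i' m'] im'] /= yx]; last first.
  rewrite block_formE //; case: ifP; rewrite ?scale0r //.
  move=> /and4P[/eqP ii /eqP mm _ _].
  by case/eqP: yx; apply: val_inj => /=; congr (_, _); apply: val_inj.
rewrite addr0 block_formE // !eqxx t_al /=.
have := @block_reduce i m (s - t) b; rewrite subnKC //; exact.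
Qed.

End Generic.

(** * The even degrees up to p - 3 *)

(** Here no coefficient of the relations between the monomials e^a h^b f^a
    vanishes, because b is odd and smaller than p in their source. All
    of them are therefore proportional to h^n. *)
Section SmallEven.
Variable n : nat.
Hypothesis n_small : (n <= p - 3)%N.
Hypothesis n_even : ~~ odd n.

(** The factor by which e^a h^(n - 2 a) f^a differs from h^n. *)
Definition chain_coef a : k :=
  \prod_(b < a) (b.+1%:R / ((n - b.*2 - 1)%:R *+ 2)).

Definition diag_form a c : k := if a == c then chain_coef a else 0.

Lemma middle_neq0 a b : (a + b + a.+1)%N = n -> b%:R *+ 2 != 0 :> k.
Proof.
move=> abc; rewrite -mulr_natl mulf_neq0 ?two_neq0 //; apply: natr_neq0.
by case: b abc => [|b] abc; first (exfalso; move: n_even; rewrite -abc); lia.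
Qed.

Lemma chain_coefS a b : (a + b + a.+1)%N = n ->
  (b%:R *+ 2) * chain_coef a.+1 = a.+1%:R * chain_coef a.
Proof.
move=> abc; rewrite /chain_coef big_ord_recr /=.
have -> : (n - a.*2 - 1)%N = b by lia.
by rewrite mulrC -mulrA divfK ?(middle_neq0 abc) // mulrC.
Qed.

Lemma diag_invE a b c : (a + b + c)%N = n ->
  c%:R * diag_form a c.-1 = (b%:R *+ 2) * diag_form a.+1 c.
Proof.
case: c => [|c] abc; rewrite /diag_form /= ?mul0r ?mulr0 // eqSS.
case: eqP => ac; last by rewrite !mulr0.
by rewrite -ac in abc *; rewrite (chain_coefS abc).
Qed.

Lemma diag_formC a c : diag_form a c = diag_form c a.
Proof. by rewrite /diag_form eq_sym; case: eqP => // ->. Qed.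

Lemma diag_reduce a b : (a + b + a)%N = n ->
  in_gS n (sl2_mon k a b a - chain_coef a *: degree_mon k n 0 0).
Proof.
elim: a b => [|a IHa] b abc.
  rewrite /chain_coef big_ord0 scale1r /degree_mon !subn0.
  have -> : b = n by lia.
  by rewrite subrr; apply: in_gS0.
have IH : in_gS n (sl2_mon k a b.+2 a - chain_coef a *: degree_mon k n 0 0).
  by apply: IHa; lia.
have abc' : (a + b.+1 + a.+1)%N = n by lia.
have := in_gS_derE k abc'; rewrite derE_mon /= => rel.
apply: (in_gS_cancel (middle_neq0 abc')).
have := in_gS_linear (-1) rel (in_gSZ a.+1%:R IH); congr in_gS.
rewrite !scalerBr !scalerA (chain_coefS abc') scaleN1r opprD scaleNr opprK.
by rewrite addrA subrK.
Qed.

Theorem Ext3_small_even :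
  Ext_dim (A := envelope (sl2 k)) 3 (env_module (trivial_module (sl2 k)))
    (env_module (sl2_sym k n)) 1.
Proof.
rewrite [X in Ext_dim _ _ _ X](esym card_unit).
apply: (@coinvariants_criterion k n unit (fun=> (0, 0)%N) (fun=> diag_form))
  => //.
- move=> _; split=> [||a b c abc]; first exact: diag_invE.
    move=> a c _; rewrite /diag_form.
    case: eqP => [->|_]; last by rewrite mulr0.
    by rewrite subrr mul0r.
  by rewrite diag_formC [X in _ = _ * X]diag_formC; apply: diag_invE; lia.
- by move=> [] []; rewrite /diag_form /chain_coef big_ord0.
move=> a b c abc; rewrite (big_pred1 tt) => [|[]] //=; rewrite /diag_form.
case: eqVneq => [ac|ac]; first by rewrite -ac; apply: diag_reduce; lia.
rewrite scale0r subr0; have := in_gS_derH k abc; rewrite derH_mon.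
apply: in_gS_cancel; rewrite -mulr_natl mulf_neq0 ?two_neq0 // subr_eq0.
by apply: contraNneq ac => /natr_eqP; rewrite !modn_small => [->||] //; lia.
Qed.

End SmallEven.

End PositiveCharacteristic.

Theorem proposition5p8 (k : fieldType) (p : nat)
    (p_char : p \in [pchar k]%R) (p_gt2 : (2 < p)%N)
    (n q r : nat) (n_def : n = (q * p + r)%N) (r_ltp : (r < p)%N) :
  let U := envelope (sl2 k) in
  let triv := env_module (trivial_module (sl2 k)) in
  let S := env_module (sl2_sym k n) in
  [/\ ((n <= p - 3)%N -> ~~ odd n -> Ext_dim (A := U) 3 triv S 1),
      (r = (p - 1)%N -> Ext_dim (A := U) 3 triv S 'C(q + 2, 2)),
      (odd r -> Ext_dim (A := U) 3 triv S 'C(q + 1, 2))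
    & ((r < p - 1)%N -> ~~ odd r -> (1 <= q)%N ->
         Ext_dim (A := U) 3 triv S 'C(q, 2))].
Proof.
move=> U triv S; have p_odd : odd p.
  by have [] := even_prime (pcharf_prime p_char); lia.
split=> [n_small n_even|rE|r_odd|r_lt r_even q_gt0].
- exact: (Ext3_small_even p_char p_gt2 n_small n_even).
- rewrite addn2.
  by apply: (Ext3_generic p_char p_gt2 (t := 0)); rewrite ?mulSn; lia.
- rewrite addn1; apply: (Ext3_generic p_char p_gt2 (t := r.+1./2)); lia.
- case: q q_gt0 n_def => // q _ n_def.
  rewrite mulSn in n_def.
  by apply: (Ext3_generic p_char p_gt2 (t := (r + p).+1./2)); lia.
Qed.
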